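(* Let $n\ge 1$ be an integer and $\xi$ a transcendental real number satisfying at least one of the following conditions: (i) $\widehat{w}_n(\xi)=n$; (ii) $\widehat{w}_n(\xi)>2n-3$; (iii) $\widehat{w}_n^{\ast}(\xi)\ge n-2$; (iv) $\lambda_n(\xi)\in\left[\frac1n,\frac1{n-2}\right]\cup(1,\infty]$; (v) $w_1(\xi)\ge n$; (vi) $w_n(\xi)\le\frac{2n-1+\sqrt{4n-3}}{2}$. Then $$\widehat{w}_n(\xi)-\widehat{w}_n^{\ast}(\xi)\le n-1.$$
   Context: Let $n\ge 1$ be an integer and $\xi$ a transcendental real number. The height $H_P$ of a polynomial $P$ is the maximum modulus of its coefficients. The height $H(\alpha)$ of an algebraic number $\alpha$ is the height of its minimal polynomial over the integers with coprime coefficients. For a real parameter $X>1$, let $P_X$ be the non-zero integer polynomial of degree at most $n$ and height at most $X$ that minimizes $|P(\xi)|$ among all such polynomials $P$ (unique up to sign). Let $\alpha_X$ be the algebraic number of degree at most $n$ and height at most $X$ that minimizes $H(\alpha)\cdot|\xi-\alpha|$ among all such $\alpha$. Define $$w(n,\xi,X)=-\frac{\log|P_X(\xi)|}{\log X},\qquad w^{\ast}(n,\xi,X)=-\frac{\log\left(H(\alpha_X)\cdot|\alpha_X-\xi|\right)}{\log X},$$ and $$w_n(\xi)=\limsup_{X\to\infty}w(n,\xi,X)\in[0,\infty],\quad \widehat{w}_n(\xi)=\liminf_{X\to\infty}w(n,\xi,X),\quad \widehat{w}_n^{\ast}(\xi)=\liminf_{X\to\infty}w^{\ast}(n,\xi,X).$$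 $w_1(\xi)$ is $w_n(\xi)$ for $n=1$. Let $\lambda_n(\xi)\in[0,\infty]$ be the supremum of the real numbers $\lambda$ such that $$\max_{1\le j\le n}|q\xi^j-p_j|\le q^{-\lambda}$$ has infinitely many solutions in integer vectors $(q,p_1,\ldots,p_n)$ with $q\ge 1$. Convention for condition (iv) when $n\le 2$: $1/(n-2)$ is read as $\infty$ if $n=2$, and an interval $[a,b]$ with $b<a$ is empty (as happens for $n=1$). *)

(* Defs.v *)
From HB Require Import structures.
From mathcomp Require Import all_boot all_order all_algebra.
From mathcomp Require Import all_classical all_reals all_analysis.
From mathcomp Require Import complex.
Set Implicit Arguments.
Unset Strict Implicit.
Unset Printing Implicit Defensive.
Import Order.TTheory GRing.Theory Num.Theory.
Import numFieldNormedType.Exports.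
Local Open Scope classical_set_scope.
Local Open Scope ring_scope.

Definition transcendental (R : realType) (xi : R) : Prop :=
  ~ algebraicOver (ratr : rat -> R) xi.

Definition algebraic_number (R : realType) (a : R[i]) : Prop :=
  algebraicOver (ratr : rat -> R[i]) a.

Definition poly_height (P : {poly int}) : nat :=
  \max_(i < size P) `|(P`_i)%R|%N.

(* [zcontents P = 1] says that the coefficients are coprime and the leading
   coefficient is positive, which singles out one of [P] and [- P]. *)
Definition is_int_minpoly (R : realType) (a : R[i]) (P : {poly int}) : Prop :=
  [/\ zcontents P = 1,
      root (map_poly intr P) a &
      forall Q : {poly int},
        Q != 0 -> root (map_poly intr Q) a -> (size P <= size Q)%N].

Definition int_minpoly (R : realType) (a : R[i]) : {poly int} :=
  xget 0 [set P | is_int_minpoly a P].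

Definition alg_height (R : realType) (a : R[i]) : nat :=
  poly_height (int_minpoly a).

Definition alg_degree (R : realType) (a : R[i]) : nat :=
  (size (int_minpoly a)).-1.

Definition poly_val (R : realType) (xi : R) (P : {poly int}) : R :=
  `|(map_poly intr P).[xi]|.

(* [normc] is the [R]-valued modulus; the norm `|_| of [R[i]] is [R[i]]-valued. *)
Definition alg_val (R : realType) (xi : R) (a : R[i]) : R :=
  (alg_height a)%:R * ComplexField.Normc.normc (xi%:C%C - a).

Definition poly_admissible (R : realType) (n : nat) (X : R) (P : {poly int}) :
    Prop :=
  [/\ P != 0, (size P <= n.+1)%N & (poly_height P)%:R <= X].

Definition alg_admissible (R : realType) (n : nat) (X : R) (a : R[i]) : Prop :=
  [/\ algebraic_number a, (alg_degree a <= n)%N & (alg_height a)%:R <= X].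

(* For [1 < X] both minima below are attained, so that the default value of
   [xget] is irrelevant; minimizers that differ (by a sign, or by complex
   conjugation) have the same [poly_val], resp. [alg_val]. *)
Definition best_poly (R : realType) (n : nat) (xi X : R) : {poly int} :=
  xget 0 [set P | poly_admissible n X P /\
    forall Q, poly_admissible n X Q -> poly_val xi P <= poly_val xi Q].

Definition best_alg (R : realType) (n : nat) (xi X : R) : R[i] :=
  xget 0 [set a | alg_admissible n X a /\
    forall b, alg_admissible n X b -> alg_val xi a <= alg_val xi b].

Definition w_at (R : realType) (n : nat) (xi X : R) : R :=
  - (ln (poly_val xi (best_poly n xi X)) / ln X).

Definition wstar_at (R : realType) (n : nat) (xi X : R) : R :=
  - (ln (alg_val xi (best_alg n xi X)) / ln X).

Definition w_sup (R : realType) (n : nat) (xi : R) : \bar R :=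
  limf_esup (fun X : R => (w_at n xi X)%:E) (pinfty_nbhs R).

Definition w_hat (R : realType) (n : nat) (xi : R) : \bar R :=
  limf_einf (fun X : R => (w_at n xi X)%:E) (pinfty_nbhs R).

Definition wstar_hat (R : realType) (n : nat) (xi : R) : \bar R :=
  limf_einf (fun X : R => (wstar_at n xi X)%:E) (pinfty_nbhs R).

(* [v.2 0 j] stands for p_(j+1), as ordinals start at 0. *)
Definition simult_solution (R : realType) (n : nat) (xi lam : R)
    (v : int * 'rV[int]_n) : Prop :=
  1 <= v.1 /\
  \big[Num.max/0]_(j < n) `|v.1%:~R * xi ^+ j.+1 - (v.2 0 j)%:~R|
    <= v.1%:~R `^ (- lam).

Definition lambda_sup (R : realType) (n : nat) (xi : R) : \bar R :=
  ereal_sup [set lam%:E | lam in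
    [set lam : R | infinite_set [set v | @simult_solution R n xi lam v]]].

Definition inv_n_minus_2 (R : realType) (n : nat) : \bar R :=
  if n == 2%N then +oo%E else (n%:R - 2)^-1%:E.

(* Main.v *)
Require Import Defs.
From mathcomp Require Import all_boot all_order all_fingroup all_algebra.
From mathcomp Require Import all_classical all_reals all_analysis.
From mathcomp Require Import complex.
From mathcomp Require Import zify ring lra.
Import Order.TTheory GRing.Theory Num.Theory.
Import numFieldNormedType.Exports.
Local Open Scope classical_set_scope.
Local Open Scope ring_scope.
Set Implicit Arguments.
Unset Strict Implicit.
Unset Printing Implicit Defensive.

(** Write h(P) for the logarithm of the height of an integer polynomial P and
    l(P) for the logarithm of |P(xi)|.  The result follows from one implication:
    if w is smaller than the uniform exponent of xi for polynomials, then the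
    uniform exponent for algebraic numbers is at least w - n + 1.  For
    w <= n - 1 the algebraic number 0 suffices, so let w > n - 1.

    For every large x some P of degree at most n has h(P) <= x and
    l(P) <= - w x.  Factor P into irreducible primitive polynomials; by
    Gelfond's inequality ([height_mul_le]) their logarithmic heights add up to
    h(P), up to a constant.  Among the factors choose the Q for which
    |Q(xi)| / H(Q) is smallest; let D be its degree and m its multiplicity.
    For any other factor S the resultant of Q and S is a nonzero integer, and
    it is small if Q and S are both small at xi.  As Q is the smaller one
    relative to its height, this bounds l(S) from below by
    - (D - 1) h(S) - deg S h(Q), up to a constant.  Removing all these S from
    P leaves, for the quantity e(Q) = l(Q) + (D - 1) h(Q),

      m e(Q) <= O(1) - (w - D + 1) x + (n - m D) h(Q)   and   m h(Q) <= x

    ([exists_dominant_factor]).  When m = 1 or m w <= m n + n - m, these two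
    inequalities alone give e(Q) <= O(1) - (w - n + 1) x.  Otherwise Q is a
    very good approximation at the low height H(Q).  For a suitable constant k
    there is an S with h(S) <= h(Q) - k and l(S) <= - w (h(Q) - k), and such an
    S is too low to be a multiple of Q.  So the resultant of Q and S is again
    nonzero, which is incompatible with the size of Q(xi) unless h(Q) is bounded
    ([repeated_dominant_bounded]).
    There are only finitely many Q of bounded height, so |Q(xi)| is then
    bounded away from 0 and x is bounded too.

    It remains to pass from Q to a number.  The root a of Q nearest to xi
    satisfies |xi - a| |Q'(a)| <= 2^D |Q(xi)|, and |Q'(a)| is at least a
    constant times H(Q)^(2 - D), because the discriminant of Q is a nonzero
    integer which is quadratic in Q'(a) and of degree 2 D - 4 in the remaining
    data.  Hence the logarithm of H(a) |xi - a| is at most e(Q) + O(1)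
    ([near_root_log]), which is the required bound. *)

(** * Determinants of coefficient matrices *)

Lemma norm_det_le (K : numDomainType) (N : nat) (A : 'M[K]_N)
    (r c : 'I_N -> K) :
  (forall i j, `|A i j| <= r i * c j) ->
  `|\det A| <= N`!%:R * (\prod_i r i * \prod_i c i).
Proof.
move=> hA; apply: le_trans (ler_norm_sum _ _ _) _.
rewrite -card_Sn -sum1_card natr_sum mulr_suml; apply: ler_sum => s _.
rewrite mul1r normrMsign normr_prod.
have -> : \prod_i c i = \prod_i c (s i).
  by rewrite (reindex_inj (@perm_inj _ s)).
by rewrite -big_split /=; apply: ler_prod => i _; rewrite normr_ge0 hA.
Qed.

Section CoefMatrix.
Variables (K : comNzRingType) (N : nat) (r : 'I_N -> {poly K}).
Hypothesis size_r : forall i, (size (r i) <= N)%N.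

Let A := \matrix_(i < N, j < N) (r i)`_j.

(** Column 0 becomes the column of values at [x] once [x ^+ k] times column [k]
    has been added to it for all [k > 0].  A column of small values makes the
    whole determinant small. *)
Lemma det_coef_horner (x : K) :
  \det A = \det (\matrix_(i < N, j < N)
                   if j == 0 :> nat then (r i).[x] else (r i)`_j).
Proof.
pose V := \matrix_(k < N, j < N)
  (if j == 0 :> nat then x ^+ k else (k == j)%:R) : 'M[K]_N.
have detV : \det V = 1.
  have trigV : is_trig_mx V.
    apply/is_trig_mxP => i j lt_ij; rewrite mxE; case: eqP => [j0|_]; first by rewrite j0 in lt_ij.
    by rewrite -val_eqE /= ltn_eqF.
  by rewrite det_trig // big1 // => i _; rewrite mxE eqxx; case: eqP => // ->.
rewrite -[LHS]mulr1 -detV -det_mulmx; congr (\det _).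
apply/matrixP => i j; rewrite !mxE.
under eq_bigr do rewrite !mxE.
case: eqP => [j0|_]; first by rewrite -horner_coef_wide.
rewrite (bigD1 j) //= eqxx mulr1 big1 ?addr0 // => k /negPf->.
by rewrite mulr0.
Qed.

Lemma horner_deriv_wide (p : {poly K}) (x : K) :
  (size p <= N)%N -> p^`().[x] = \sum_(k < N) p`_k * ('X^k)^`().[x].
Proof.
move=> size_p; have {1}-> : p = \sum_(k < N) p`_k *: 'X^k.
  rewrite -poly_def; apply/polyP => k; rewrite coef_poly.
  by case: ltnP => // /(leq_trans size_p)/leq_sizeP->.
rewrite raddf_sum horner_sum; apply: eq_bigr => k _.
by rewrite /= derivZ hornerZ.
Qed.

(** Same idea with two columns, for values and derivatives.  The free parameter
    [t] serves to cancel the second derivatives that occur when the rows are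
    built from a polynomial and its derivative. *)
Lemma det_coef_horner2 (x t : K) :
  \det A = \det (\matrix_(i < N, j < N)
    if j == 0 :> nat then (r i).[x]
    else if j == 1 :> nat then (r i)^`().[x] - t * (r i).[x]
    else (r i)`_j).
Proof.
pose V := \matrix_(k < N, j < N)
  (if j == 0 :> nat then x ^+ k
   else if j == 1 :> nat then ('X^k)^`().[x] else (k == j)%:R) : 'M[K]_N.
have detV : \det V = 1.
  have trigV : is_trig_mx V.
    apply/is_trig_mxP => i j lt_ij; rewrite mxE; case: eqP => [j0|_]; first by rewrite j0 in lt_ij.
    case: eqP => [j1|_]; last by rewrite -val_eqE /= ltn_eqF.
    by move: lt_ij; rewrite j1 ltnS leqn0 => /eqP->; rewrite derivC horner0.
  rewrite det_trig // big1 // => i _; rewrite mxE eqxx; case: eqP => [->//|_].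
  by case: eqP => // ->; rewrite derivX hornerC.
pose W := \matrix_(k < N, j < N)
  ((k == j)%:R - t * ((k == 0 :> nat) && (j == 1 :> nat))%:R) : 'M[K]_N.
have detW : \det W = 1.
  have trigW : is_trig_mx W^T.
    apply/is_trig_mxP => i j lt_ij; rewrite !mxE eq_sym -val_eqE /= ltn_eqF //.
    by case: eqP => [j0|_]; [rewrite j0 in lt_ij | rewrite mulr0 subr0].
  rewrite -det_tr det_trig // big1 // => i _; rewrite !mxE eqxx.
  by case: eqP => [->|_]; rewrite mulr0 subr0.
rewrite -[LHS]mulr1 -detV -det_mulmx -[LHS]mulr1 -detW -det_mulmx.
have AVE i j : (A *m V) i j = if j == 0 :> nat then (r i).[x]
    else if j == 1 :> nat then (r i)^`().[x] else (r i)`_j.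
  rewrite !mxE; under eq_bigr do rewrite !mxE.
  case: eqP => [j0|_]; first by rewrite -horner_coef_wide.
  case: eqP => [j1|_]; first by rewrite -horner_deriv_wide.
  rewrite (bigD1 j) //= eqxx mulr1 big1 ?addr0 // => k /negPf->.
  by rewrite mulr0.
congr (\det _); apply/matrixP => i j; rewrite !mxE.
under eq_bigr do rewrite AVE mxE mulrBr.
rewrite sumrB (bigD1 j) //= eqxx mulr1 big1 ?addr0; last first.
  by move=> k /negPf->; rewrite mulr0.
case: eqP => [j0|_]; first by rewrite j0 big1 ?subr0 // => k _; rewrite andbF !mulr0.
case: eqP => [j1|_]; last by rewrite big1 ?subr0 // => k _; rewrite andbF !mulr0.
have N0 : (0 < N)%N by apply: leq_ltn_trans (ltn_ord j).
rewrite (bigD1 (Ordinal N0)) //= mulr1 mulrC big1 ?addr0 // => k.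
by rewrite -val_eqE /= => /negPf->; rewrite !mulr0.
Qed.

End CoefMatrix.

Definition sylvester_row (K : nzRingType) (p q : {poly K})
    (i : 'I_((size q).-1 + (size p).-1)) : {poly K} :=
  match fintype.split i with inl k => 'X^k * p | inr k => 'X^k * q end.
Arguments sylvester_row {K} p q i.

Lemma Sylvester_mx_row (K : nzRingType) (p q : {poly K}) :
  Sylvester_mx p q = \matrix_(i, j) (sylvester_row p q i)`_j.
Proof.
apply/matrixP => i j; rewrite Sylvester_mxE !mxE /sylvester_row.
by case: fintype.split => k; rewrite coefXnM ltnNge; case: leqP.
Qed.

Lemma size_sylvester_row (K : idomainType) (p q : {poly K}) i :
  (0 < size p)%N -> (0 < size q)%N ->
  (size (sylvester_row p q i) <= (size q).-1 + (size p).-1)%N.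
Proof.
have shift m a b : (0 < a)%N -> (m < b.-1)%N -> (m + a <= b.-1 + a.-1)%N.
  by lia.
rewrite /sylvester_row => p0 q0; case: fintype.splitP => k _; rewrite mulrC.
  by rewrite size_mulXn -?size_poly_gt0 // shift.
by rewrite size_mulXn -?size_poly_gt0 // [leqRHS]addnC shift.
Qed.

(** * Lower bounds from resultants and discriminants *)

Section ResultantBounds.
Variable K : numFieldType.
Implicit Types (p q : {poly int}) (x : K).

Local Notation "p ^K" := (map_poly intr p : {poly K})
  (at level 2, format "p ^K").

Lemma norm_int_ge1 (z : int) : z != 0 -> 1 <= `|z%:~R : K|.
Proof. by move=> z0; rewrite -intr_norm -[1]/(1%:~R) ler_int; lia. Qed.

Lemma norm_coef_le (h : nat) p (i : nat) :
  (forall i : nat, (`|(p`_i)%R| <= h)%N) -> `|p^K`_i| <= h%:R.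
Proof. by move=> /(_ i) hp; rewrite coef_map /= -intr_norm -natr_absz ler_nat. Qed.

Lemma norm_expr_le (b n k : nat) x :
  (0 < b)%N -> `|x| <= b%:R -> (k <= n)%N -> `|x ^+ k| <= (b ^ n)%:R.
Proof.
move=> b0 xb kn; rewrite normrX natrX (@le_trans _ _ (b%:R ^+ k)) //.
  by rewrite lerXn2r ?nnegrE ?ler0n.
by rewrite ler_weXn2l // ler1n.
Qed.

Lemma map_sylvester_row p q i :
  (sylvester_row p q i)^K = match fintype.split i with
    | inl k => 'X^k * p^K | inr k => 'X^k * q^K end :> {poly K}.
Proof.
by rewrite /sylvester_row; case: fintype.split => k; rewrite rmorphM /= map_polyXn.
Qed.

Lemma resultant_coef_det p q :
  (resultant p q)%:~R =
  \det (\matrix_(i, j) ((sylvester_row p q i)^K)`_j) :> K.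
Proof.
rewrite /resultant -det_map_mx Sylvester_mx_row; congr (\det _).
by apply/matrixP => i j; rewrite !mxE coef_map.
Qed.

Lemma size_map_sylvester_row p q i : (0 < size p)%N -> (0 < size q)%N ->
  (size (sylvester_row p q i)^K <= (size q).-1 + (size p).-1)%N.
Proof.
move=> p0 q0; rewrite size_map_inj_poly ?size_sylvester_row //.
exact: intr_inj.
Qed.

Lemma norm_sylvester_row_coef p q (hp hq : nat) i j :
  (forall i : nat, (`|(p`_i)%R| <= hp)%N) -> (forall i : nat, (`|(q`_i)%R| <= hq)%N) ->
  `|((sylvester_row p q i)^K)`_j| <=
     (match fintype.split i with inl _ => hp | inr _ => hq end)%:R.
Proof.
move=> Hp Hq; rewrite map_sylvester_row; case: fintype.split => k;
by rewrite coefXnM; case: ifP => _; rewrite ?normr0 ?norm_coef_le.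
Qed.

(** The resultant is a nonzero integer.  In the Sylvester matrix with column 0
    replaced by values at [x], each row is bounded by the height of its
    polynomial, and column 0 gains the further factor [d]. *)
Lemma resultant_lower_bound (n b hp hq : nat) x p q (d : K) :
    coprimep p q -> (1 < size p <= n.+1)%N -> (0 < size q <= n.+1)%N ->
    (0 < b)%N -> `|x| <= b%:R ->
    (forall i : nat, (`|(p`_i)%R| <= hp)%N) -> (forall i : nat, (`|(q`_i)%R| <= hq)%N) ->
    `|p^K.[x]| <= d * hp%:R -> `|q^K.[x]| <= d * hq%:R -> 0 <= d ->
  1 <= ((n + n)`! * b ^ n * hp ^ (size q).-1 * hq ^ (size p).-1)%:R * d.
Proof.
move=> cop /andP[p1 pn] /andP[q0 qn] b0 xb Hp Hq px qx d0.
have p0 : (0 < size p)%N by apply: ltnW.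
have res0 : resultant p q != 0.
  by rewrite resultant_eq0 -leqNgt; rewrite coprimep_def in cop; rewrite (eqP cop).
apply: le_trans (norm_int_ge1 res0) _; rewrite resultant_coef_det.
rewrite (det_coef_horner (fun i => size_map_sylvester_row i p0 q0) x).
pose r (i : 'I_((size q).-1 + (size p).-1)) : K :=
  (match fintype.split i with inl _ => hp | inr _ => hq end)%:R.
pose c (j : 'I_((size q).-1 + (size p).-1)) : K :=
  if j == 0 :> nat then (b ^ n)%:R * d else 1.
apply: le_trans (@norm_det_le _ _ _ r c _) _.
  move=> i j; rewrite mxE /c; case: eqP => _; last first.
    by rewrite mulr1 norm_sylvester_row_coef.
  have entry k h (t : {poly K}) : (k <= n)%N -> `|t.[x]| <= d * h%:R ->
      `|('X^k * t).[x]| <= h%:R * ((b ^ n)%:R * d).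
    move=> kn tx; rewrite hornerM hornerXn normrM mulrCA [h%:R * d]mulrC.
    by rewrite ler_pM ?normr_ge0 // norm_expr_le.
  rewrite map_sylvester_row /r; case: fintype.split => k; apply: entry => //.
    by apply: leq_trans (ltnW (ltn_ord k)) _; rewrite -subn1 leq_subLR.
  by apply: leq_trans (ltnW (ltn_ord k)) _; rewrite -subn1 leq_subLR.
have -> : \prod_i c i = (b ^ n)%:R * d.
  have N0 : (0 < (size q).-1 + (size p).-1)%N by lia.
  rewrite (bigD1 (Ordinal N0)) //= /c /= big1 ?mulr1 // => i.
  by rewrite -val_eqE /= => /negPf->.
have -> : \prod_i r i = (hp ^ (size q).-1 * hq ^ (size p).-1)%:R.
  rewrite big_split_ord natrM !natrX /r /=; congr (_ * _).
    under eq_bigr do rewrite -/(unsplit (inl _)) unsplitK.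
    by rewrite prodr_const card_ord.
  under eq_bigr do rewrite -/(unsplit (inr _)) unsplitK.
  by rewrite prodr_const card_ord.
rewrite mulrA -natrM mulrA -natrM ler_wpM2r // ler_nat -!mulnA.
rewrite leq_mul //; first by apply: leq_fact; lia.
by rewrite mulnA mulnC.
Qed.

Lemma size_coef_lead p d : (size p <= d.+1)%N -> p`_d != 0 -> size p = d.+1.
Proof.
move=> sp pd; apply/eqP; rewrite eqn_leq sp ltnNge.
by apply: contra pd => /leq_sizeP->.
Qed.

(** The polar derivative of [p] with respect to the pole [k].  With [p^`()] it
    spans the two partial derivatives of the homogenization of [p] in degree
    [d], so that their resultant is the discriminant of [p] up to a factor that
    depends on [d] only, whereas the resultant of [p] and [p^`()] has the extra
    factor [lead_coef p]. *)
Definition polar_deriv (k : int) (d : nat) p : {poly int} :=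
  p *+ d - ('X - k%:P) * p^`().

Lemma coef_polar_deriv k d p i :
  (polar_deriv k d p)`_i = p`_i *+ d - p`_i *+ i + k * (p`_i.+1 *+ i.+1).
Proof.
rewrite /polar_deriv coefB coefMn mulrBl coefB coefXM coefCM !coef_deriv.
case: i => [|i] /=; last by rewrite opprB addrA addrAC.
by rewrite mulr0n subr0 sub0r opprK.
Qed.

Lemma prod_ord_lt2 N (u v : K) : (1 < N)%N ->
  \prod_(j < N) (if (j < 2)%N then u else v) = u ^+ 2 * v ^+ (N - 2).
Proof.
case: N => [|[|N]] // _; rewrite !big_ord_recl /= mulrA subSS subSS subn0.
by congr (_ * _); rewrite prodr_const card_ord.
Qed.

(** A quantitative form of the nonvanishing of the discriminant.  At a root [x]
    of [p], both [p^`()] and the polar derivative take values proportional to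
    [p^`().[x]], and so do the entries of the second modified column for a
    suitable [t]; hence the determinant contains the square of [p^`().[x]], and
    the height enters through the other columns only. *)
Lemma deriv_root_lower_bound (n b h : nat) (x : K) p :
    coprimep p p^`() -> (2 < size p <= n.+1)%N -> (0 < b)%N -> `|x| <= b%:R ->
    (forall i : nat, (`|(p`_i)%R| <= h)%N) -> root p^K x ->
  1 <= ((n + n)`! * (n * b ^ n * (b + 2)) ^ 2 * (2 * n) ^ (n + n)
         * h ^ ((size p - 3) * 2))%:R * `|p^K^`().[x]| ^+ 2.
Proof.
move=> cop /andP[p3 pn] b0 xb hp /rootP px.
case sp : (size p) p3 pn => [|[|[|d]]] // _ dn.
have lead_p : p`_d.+2 != 0.
  have : lead_coef p != 0 by rewrite lead_coef_eq0 -size_poly_eq0 sp.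
  by rewrite lead_coefE sp.
have n2 : (2 <= n)%N by lia.
have sF : size p^`() = d.+2.
  apply: size_coef_lead; last by rewrite coef_deriv -mulr_natr mulf_neq0 ?pnatr_eq0.
  by rewrite -ltnS -sp lt_size_deriv // -size_poly_eq0 sp.
(* The pole is chosen so that the polar derivative has full degree. *)
pose k : int := (p`_d.+1 == 0)%:R.
pose G := polar_deriv k d.+2 p.
have sG : size G = d.+2.
  apply: size_coef_lead.
    apply/leq_sizeP => j; rewrite leq_eqVlt => /predU1P[<-|dj].
      rewrite coef_polar_deriv subrr add0r.
      by have /leq_sizeP-> // : (size p <= d.+3)%N; rewrite ?sp // mul0rn mulr0.
    rewrite coef_polar_deriv; have /leq_sizeP sp' : (size p <= j)%N by rewrite sp.
    by rewrite !sp' ?mul0rn ?mulr0 ?subr0 ?addr0 //.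
  rewrite coef_polar_deriv -mulrnBr // subSnn mulr1n /k.
  by case: (p`_d.+1 =P 0) => [->|/eqP]; rewrite ?add0r ?mul0r ?addr0 // mul1r -mulr_natr mulf_neq0 ?pnatr_eq0.
have res0 : resultant p^`() G != 0.
  rewrite resultant_eq0 -leqNgt -[X in (_ <= X)%N](eqP cop) dvdp_leq //.
    by rewrite -size_poly_eq0 (eqP cop).
  rewrite dvdp_gcd dvdp_gcdl andbT; have := dvdp_gcdr p^`() G.
  set g := gcdp _ _; rewrite /G /polar_deriv dvdp_addl; last first.
    by rewrite dvdpNr dvdp_mull // dvdp_gcdl.
  by rewrite -scaler_nat dvdpZr // pnatr_eq0.
have abszMn (z : int) m : `|(z *+ m)%R|%N = (`|z| * m)%N.
  by rewrite -mulr_natr abszM natz.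
have hp_deriv j : (`|(p`_j *+ j)%R| <= n * h)%N.
  rewrite abszMn mulnC; have [jd|jd] := ltnP j d.+3; first by rewrite leq_mul //; lia.
  by rewrite [p`_j]nth_default ?sp // absz0 muln0.
set y := p^K^`().[x].
have y0 : y != 0.
  apply/eqP => yE.
  have bad := @resultant_lower_bound n b h (n * h) x p p^`() 0 cop.
  suff: (1 <= 0 :> K) by move=> h10; rewrite ler10 in h10.
  rewrite -[X in _ <= X](mulr0 (((n + n)`! * b ^ n * h ^ (size p^`()).-1 * (n * h) ^ (size p).-1)%:R)).
  apply: bad => //.
  - by rewrite sp.
  - by rewrite sF /= ltnW.
  - by move=> i; rewrite coef_deriv.
  - by rewrite px normr0 mul0r.
  - by rewrite -deriv_map -/y yE normr0 mul0r.
set y2 := p^K^`()^`().[x].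
have GK : G^K = p^K *+ d.+2 - ('X - (k%:~R)%:P) * p^K^`().
  by rewrite /G /polar_deriv rmorphB rmorphMn rmorphM rmorphB /= map_polyX map_polyC -deriv_map.
have Gx : G^K.[x] = - (x - k%:~R) * y.
  by rewrite GK hornerD hornerN hornerMn px mul0rn sub0r hornerM hornerXsubC mulNr.
have G'x : G^K^`().[x] = (d.+1)%:R * y - (x - k%:~R) * y2.
  rewrite GK derivB derivMn derivM derivB derivX derivC subr0 mul1r.
  rewrite hornerD hornerN hornerMn hornerD hornerM hornerXsubC -/y -/y2.
  by rewrite opprD addrA mulrSr addrK mulr_natl.
have F0 : (0 < size p^`())%N by rewrite sF.
have G0 : (0 < size G)%N by rewrite sG.
apply: le_trans (norm_int_ge1 res0) _; rewrite resultant_coef_det.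
rewrite (det_coef_horner2 (fun i => size_map_sylvester_row i F0 G0) x (y2 / y)).
pose c (j : 'I_((size G).-1 + (size p^`()).-1)) : K :=
  if (j < 2)%N then (n * b ^ n * (b + 2))%:R * `|y| else (2 * n * h)%:R.
apply: le_trans (@norm_det_le _ _ _ (fun=> 1) c _) _.
  move=> i j; rewrite mxE mul1r /c.
  (* With t = y2 / y the second derivative y2 drops out of column 1. *)
  have row k0 (T : {poly K}) (tau sigma : K) : (k0 <= n)%N ->
      T.[x] = tau * y -> T^`().[x] = sigma * y + tau * y2 ->
      `|tau| <= (b + 1)%:R -> `|sigma| <= n%:R ->
      (`|('X^k0 * T).[x]| <= (n * b ^ n * (b + 2))%:R * `|y|) *
      (`|('X^k0 * T)^`().[x] - y2 / y * ('X^k0 * T).[x]|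
         <= (n * b ^ n * (b + 2))%:R * `|y|).
    move=> k0n Tx T'x tb sb; split.
      rewrite hornerM hornerXn Tx mulrA normrM ler_wpM2r // normrM.
      apply: le_trans (_ : (b ^ n)%:R * (b + 1)%:R <= _).
        by rewrite ler_pM ?norm_expr_le.
      by rewrite -natrM ler_nat; nia.
    have -> : ('X^k0 * T)^`().[x] - y2 / y * ('X^k0 * T).[x] =
        (x ^+ k0.-1 *+ k0 * tau + x ^+ k0 * sigma) * y.
      rewrite derivM derivXn hornerD !hornerM hornerMn !hornerXn Tx T'x.
      by field.
    rewrite normrM ler_wpM2r //; apply: le_trans (ler_normD _ _) _.
    rewrite !normrM normrMn.
    apply: le_trans (_ : (b ^ n)%:R *+ n * (b + 1)%:R + (b ^ n)%:R * n%:R <= _).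
      apply: lerD; last by rewrite ler_pM ?norm_expr_le.
      rewrite ler_pM ?mulrn_wge0 //.
      apply: le_trans (_ : `|x ^+ k0.-1| *+ n <= _); first by rewrite ler_wpMn2l.
      by rewrite lerMn2r norm_expr_le ?orbT // (leq_trans (leq_pred _)).
    by rewrite -mulr_natr -!natrM -natrD ler_nat; nia.
  have {row} row : (`|((sylvester_row p^`() G i)^K).[x]|
        <= (n * b ^ n * (b + 2))%:R * `|y|) *
      (`|((sylvester_row p^`() G i)^K)^`().[x]
          - y2 / y * ((sylvester_row p^`() G i)^K).[x]|
         <= (n * b ^ n * (b + 2))%:R * `|y|).
    rewrite map_sylvester_row; case: fintype.split => k0.
      apply: (row _ _ 1 0); rewrite -?deriv_map ?mul1r ?mul0r ?add0r //.
      - by apply: leq_trans (ltnW (ltn_ord k0)) _; rewrite sG /=; lia.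
      - by rewrite normr1 ler1n addn1.
      - by rewrite normr0.
    apply: (row _ _ (- (x - k%:~R)) d.+1%:R); rewrite ?mulNr //.
    - by apply: leq_trans (ltnW (ltn_ord k0)) _; rewrite sF /=; lia.
    - by rewrite Gx mulNr.
    - rewrite normrN (le_trans (ler_normB _ _)) // natrD lerD //.
      by rewrite /k; case: eqP; rewrite ?normr1 ?normr0.
    - by rewrite normr_nat ler_nat; lia.
  case: eqP => [j0|/eqP j0]; first by rewrite j0 row.
  case: eqP => [j1|/eqP j1]; first by rewrite j1 row.
  have -> : (j < 2)%N = false by move: j0 j1; case: (nat_of_ord j) => [|[|]].
  apply: le_trans (@norm_sylvester_row_coef _ _ (2 * n * h) (2 * n * h) _ _ _ _) _.
  - move=> l; rewrite coef_deriv; apply: leq_trans (hp_deriv _) _.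
    by rewrite -mulnA leq_pmull.
  - move=> l; rewrite /G coef_polar_deriv.
    have [ld|ld] := ltnP l d.+3; last first.
      rewrite !nth_default ?sp ?mul0rn ?subr0 ?add0r ?mulr0 ?absz0 //.
      exact: leq_trans ld _.
    rewrite -mulrnBr; last by [].
    have -> : (2 * n * h = n * h + n * h)%N by rewrite -mulnA mulSn mul1n.
    have le1 : (`|(p`_l *+ (d.+2 - l))%R| <= n * h)%N.
      by rewrite abszMn mulnC leq_mul //; lia.
    apply: leq_trans (leq_add le1 (hp_deriv l.+1)).
    rewrite /k; case: (_ == 0); rewrite ?mul1r ?mul0r ?addr0 ?leq_addr //.
    by move: (_ *+ _) (_ *+ _) => u v; lia.
  by case: fintype.split.
rewrite big1_eq mul1r.
rewrite /c prod_ord_lt2 sF sG; last by lia.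
have -> : (d.+2.-1 + d.+2.-1 - 2 = d * 2)%N by lia.
have -> : (d.+3 - 3)%N = d by lia.
rewrite exprMn -!natrX mulrAC mulrA -natrM ler_wpM2r ?exprn_ge0 //.
rewrite -natrM ler_nat (expnMn (2 * n)); move: ((_ * (b + 2)) ^ 2)%N => A2.
rewrite !mulnA leq_mul // leq_mul //; last by rewrite leq_pexp2l //; lia.
by rewrite leq_mul // leq_fact //; lia.
Qed.

End ResultantBounds.

(** * Roots of complex polynomials *)

Lemma exists_min_seq (T : eqType) (K : numDomainType) (f : T -> K) (s : seq T) :
  (forall x, f x \is Num.real) -> s != [::] ->
  exists2 x, x \in s & forall y, y \in s -> f x <= f y.
Proof.
move=> fR; elim: s => [//|a s IHs] _; have [->|/IHs[x xs xmin]] := eqVneq s [::].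
  by exists a; rewrite ?mem_head // => y; rewrite inE => /eqP->.
have [ax|/ltW xa] := real_leP (fR a) (fR x).
  exists a; rewrite ?mem_head // => y; rewrite inE => /predU1P[->//|/xmin].
  exact: le_trans.
by exists x => [|y]; rewrite inE ?xs ?orbT // => /predU1P[->|/xmin].
Qed.

Section RootPeeling.
Variable K : numFieldType.
Implicit Types (A B : {poly K}) (a b : K).

Lemma size_XsubCM a B : B != 0 -> size (('X - a%:P) * B) = (size B).+1.
Proof. by move=> B0; rewrite size_monicM ?monicXsubC // size_XsubC. Qed.

(** Division by a linear factor does not increase coefficients by more than a
    factor [n]: run the recursion for the quotient from the top if [`|a| <= 1]
    and from the bottom otherwise, so that errors are never amplified. *)
Lemma coef_divXsubC_bound (n : nat) a b B :
    (size (('X - a%:P) * B)%R <= n.+1)%N ->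
    (forall i, `|(('X - a%:P) * B)`_i| <= b) ->
  forall k, `|B`_k| <= n%:R * b /\ `|a * B`_k| <= n%:R * b.
Proof.
move=> sz hb k.
have b0 : 0 <= b by apply: le_trans (hb 0%N).
have nb0 : 0 <= n%:R * b by rewrite mulr_ge0.
have Bn i : (n <= i)%N -> B`_i = 0.
  have [->|B0] := eqVneq B 0; first by rewrite coef0.
  by move=> ni; rewrite nth_default // (leq_trans _ ni) // -ltnS -(size_XsubCM a) // sz.
have hB i : `|(if i == 0%N then 0 else B`_i.-1) - a * B`_i| <= b.
  by have := hb i; rewrite mulrBl coefB coefXM coefCM.
have [kn|/Bn->] := ltnP k n; last by rewrite mulr0 normr0.
have [a1|/ltW a1] := real_leP (normr_real a) (@real1 K).
  have down j : (j <= n)%N -> `|B`_(n - j)| <= j%:R * b.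
    elim: j => [|j IHj] jn; first by rewrite subn0 Bn // normr0 mul0r.
    have := hB (n - j)%N; have -> : (n - j == 0)%N = false by lia.
    have -> : (n - j).-1 = (n - j.+1)%N by lia.
    move=> h; rewrite -[B`_(n - j.+1)](subrK (a * B`_(n - j))).
    rewrite mulrSr mulrDl mul1r addrC (le_trans (ler_normD _ _)) // lerD // ?IHj 1?ltnW //.
    rewrite normrM (le_trans _ (IHj _)) 1?ltnW // ler_piMl //.
  have Bk : `|B`_k| <= n%:R * b.
    have := down (n - k)%N (leq_subr _ _); rewrite subKn 1?ltnW // => h.
    by apply: le_trans h _; rewrite ler_wpM2r // ler_nat leq_subr.
  by split=> //; rewrite normrM; apply: le_trans Bk; rewrite ler_piMl.
have up j : `|a * B`_j| <= j.+1%:R * b.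
  elim: j => [|j IHj]; first by have := hB 0%N; rewrite sub0r normrN mul1r.
  have := hB j.+1; rewrite /= -normrN opprB => h.
  rewrite -[a * _](subrK B`_j) mulrSr mulrDl mul1r addrC.
  rewrite (le_trans (ler_normD _ _)) // lerD //.
  by apply: le_trans IHj; rewrite normrM ler_peMl.
have aBk : `|a * B`_k| <= n%:R * b.
  by apply: le_trans (up k) _; rewrite ler_wpM2r // ler_nat.
by split=> //; apply: le_trans aBk; rewrite normrM ler_peMl.
Qed.

(** Gelfond's inequality, by moving the linear factors of [A] one at a time out
    of the product [A * B]. *)
Lemma coef_mul_prod_XsubC_bound (n : nat) (s : seq K) (c b : K) B :
    let A := c *: \prod_(z <- s) ('X - z%:P) in
    (size (A * B)%R <= n.+1)%N -> (forall i, `|(A * B)`_i| <= b) ->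
  forall i j, `|A`_i| * `|B`_j| <= (2 * n)%:R ^+ size s * b.
Proof.
elim: s c b => [|a s IHs] c b A.
  rewrite /A big_nil /= mul1r => _ hb i j.
  rewrite alg_polyC; apply: le_trans (hb j); rewrite alg_polyC mul_polyC coefZ normrM ler_wpM2r //.
  by rewrite coefC; case: eqP; rewrite ?normr0.
have AE : A = ('X - a%:P) * (c *: \prod_(z <- s) ('X - z%:P)).
  by rewrite /A big_cons -scalerAr.
rewrite AE -mulrA => sz hb i j.
have bnd := coef_divXsubC_bound sz hb.
set A' := c *: _ in sz hb bnd *.
have sz' d : (size (d *: A' * B)%R <= n.+1)%N.
  rewrite -scalerAl; have [-> |A0] := eqVneq (A' * B) 0.
    by rewrite scaler0 size_poly0.
  rewrite (leq_trans (size_scale_leq _ _)) // ltnW //.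
  by move: sz; rewrite size_XsubCM.
have ih1 : `|A'`_i.-1| * `|B`_j| <= (2 * n)%:R ^+ size s * (n%:R * b).
  apply: IHs => [|l]; last by have [] := bnd l.
  by have := sz' 1; rewrite scale1r.
(* The factor a is absorbed into the leading constant of A'. *)
have ih2 : `|a * A'`_i| * `|B`_j| <= (2 * n)%:R ^+ size s * (n%:R * b).
  have := IHs (a * c) (n%:R * b); rewrite -scalerA -/A' => ih.
  by rewrite -coefZ; apply: ih => // l; rewrite -scalerAl coefZ; have [] := bnd l.
rewrite mulrBl coefB coefXM coefCM.
apply: le_trans (_ : (`|A'`_i.-1| + `|a * A'`_i|) * `|B`_j| <= _).
  rewrite ler_wpM2r // (le_trans (ler_normB _ _)) // lerD2r.
  by case: eqP; rewrite ?normr0.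
rewrite mulrDl; apply: le_trans (lerD ih1 ih2) _.
rewrite /= exprSr natrM -mulr2n -mulr_natl le_eqVlt; apply/orP; left.
by apply/eqP; ring.
Qed.

End RootPeeling.

(** The root [z] nearest to [x]: any other root [y] is at distance at most
    [2 * `|x - y|] from [z], and [p^`().[z]] is the product of these distances
    with the leading coefficient. *)
Lemma near_root (K : numClosedFieldType) (p : {poly K}) (x : K) :
    (1 < size p)%N ->
  exists z, [/\ root p z,
    `|x - z| ^+ (size p).-1 * `|lead_coef p| <= `|p.[x]|,
    `|x - z| * `|p^`().[z]| <= 2%:R ^+ (size p).-1 * `|p.[x]| &
    size p = 2%N -> p = lead_coef p *: ('X - z%:P)].
Proof.
move=> p1; have [s pE] := closed_field_poly_normal p.
have c0 : lead_coef p != 0 by rewrite lead_coef_eq0 -size_poly_gt0 ltnW.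
have sz : size p = (size s).+1.
  by rewrite {1}pE size_scale // size_prod_XsubC.
have s0 : s != [::] by apply: contraTneq p1 => s0; rewrite sz s0.
have [z zs zmin] := exists_min_seq (fun y => normr_real (x - y)) s0.
have pE' : p = ('X - z%:P) * (lead_coef p *: \prod_(y <- rem z s) ('X - y%:P)).
  by rewrite {1}pE (perm_big _ (perm_to_rem zs)) big_cons -scalerAr.
set c := lead_coef p in c0 pE pE' *.
set G := c *: \prod_(y <- rem z s) _ in pE'.
have Gx y : `|G.[y]| = `|c| * \prod_(w <- rem z s) `|y - w|.
  rewrite /G hornerZ normrM horner_prod normr_prod; congr (_ * _).
  by apply: eq_bigr => w _; rewrite hornerXsubC.
have px : `|p.[x]| = `|x - z| * `|G.[x]| by rewrite pE' hornerM hornerXsubC normrM.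
exists z; split.
- by rewrite /root pE' hornerM hornerXsubC subrr mul0r.
- rewrite sz /= pE hornerZ horner_prod normrM normr_prod mulrC ler_wpM2l //.
  have -> : `|x - z| ^+ size s = \prod_(w <- s) `|x - z|.
    by rewrite big_const_seq iter_mulr_1 count_predT.
  rewrite big_seq [leRHS]big_seq; apply: ler_prod => w /zmin h.
  by rewrite hornerXsubC normr_ge0.
- rewrite sz px mulrCA ler_wpM2l // pE' derivM derivXsubC mul1r hornerD hornerM.
  rewrite hornerXsubC subrr mul0r addr0 !Gx mulrCA ler_wpM2l //.
  apply: le_trans (_ : \prod_(w <- rem z s) (2%:R * `|x - w|) <= _).
    rewrite big_seq [leRHS]big_seq; apply: ler_prod => w /mem_rem/zmin h.
    rewrite normr_ge0 mulr_natl mulr2n /=.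
    rewrite (le_trans (ler_distD x _ _)) // lerD2r distrC //.
  rewrite big_split /= ler_wpM2r ?prodr_ge0 // big_const_seq iter_mulr_1 count_predT.
  rewrite ler_weXn2l ?ler1n // size_rem // leq_pred //.
by rewrite sz pE => -[]; case: (s) zs => [//|y [|//]] /[1!inE] /eqP-> _; rewrite big_seq1.
Qed.

(** * Irreducible factors of integer polynomials *)

Section IntegerPolynomials.
Implicit Types P Q S : {poly int}.

(** Irreducibility over the rationals, normalized by primitivity and a positive
    leading coefficient so that associated polynomials are equal.  Divisibility
    is pseudo-divisibility, which ignores integer constants. *)
Definition prime_poly Q : Prop :=
  [/\ zcontents Q = 1, (1 < size Q)%N &
      forall S, S %| Q -> (1 < size S)%N -> size S = size Q].

Lemma prime_poly_neq0 Q : prime_poly Q -> Q != 0.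
Proof. by case=> _ Q1 _; rewrite -size_poly_gt0 ltnW. Qed.

Lemma zprimitive_id1 Q : zcontents Q = 1 -> zprimitive Q = Q.
Proof. by move=> Q1; rewrite [RHS]zpolyEprim Q1 scale1r. Qed.

Lemma primitive_dvdp_eq Q P :
  zcontents Q = 1 -> zcontents P = 1 -> Q %| P -> (size P <= size Q)%N -> P = Q.
Proof.
move=> Q1 P1 /dvdpP_int[r PE] sP.
have P0 : P != 0 by rewrite -zcontents_eq0 P1.
rewrite zprimitive_id1 // in PE.
have /andP[Q0 r0] : (Q != 0) && (r != 0) by rewrite -negb_or -mulf_eq0 -PE.
have r1 : size r = 1%N.
  move: sP; rewrite PE size_mul // -subn1 leq_subLR addnC leq_add2r => sr.
  by apply/eqP; rewrite eqn_leq sr size_poly_gt0.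
have rC : r = r`_0 *: 1 by rewrite alg_polyC -size1_polyC ?r1.
have : zcontents r = 1 by move: P1; rewrite PE zcontentsM Q1 mul1r.
rewrite rC zcontentsZ zcontents_monic ?monic1 // mulr1 => r01.
by rewrite PE rC r01 scale1r mulr1.
Qed.

Lemma prime_poly_coprime Q S :
  prime_poly Q -> ~~ (Q %| S) -> coprimep Q S.
Proof.
case=> Q1 sQ irr; apply: contraNT; rewrite coprimep_def => g1.
have Q0 : Q != 0 by rewrite -size_poly_gt0 ltnW.
have g0 : gcdp Q S != 0 by rewrite gcdp_eq0 negb_and Q0.
have gQ := irr _ (dvdp_gcdl Q S).
have /eqP sg : size (gcdp Q S) == size Q.
  by apply/eqP/gQ; rewrite ltn_neqAle eq_sym g1 size_poly_gt0.
have : gcdp Q S %= Q by rewrite -dvdp_size_eqp ?dvdp_gcdl // sg.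
by move=> /eqp_dvdl <-; rewrite dvdp_gcdr.
Qed.

Lemma prime_poly_coprime_neq Q S :
  prime_poly Q -> prime_poly S -> Q != S -> coprimep Q S.
Proof.
move=> pQ pS QS; apply: prime_poly_coprime => //; apply: contra QS => QS.
case: (pQ) (pS) => Q1 sQ _ [S1 _ /(_ _ QS sQ) sz].
by apply/eqP/esym/primitive_dvdp_eq => //; rewrite sz.
Qed.

Lemma prime_poly_separable Q : prime_poly Q -> coprimep Q Q^`().
Proof.
move=> pQ; apply: prime_poly_coprime => //.
have Q0 := prime_poly_neq0 pQ; case: pQ => _ sQ _.
have d0 : Q^`() != 0.
  apply/eqP => /polyP/(_ (size Q).-2); rewrite coef_deriv coef0.
  have -> : (size Q).-2.+1 = (size Q).-1 by case: (size Q) sQ => [|[]].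
  by rewrite -lead_coefE => /eqP; rewrite -mulr_natr mulf_eq0 lead_coef_eq0 (negPf Q0) pnatr_eq0; case: (size Q) sQ => [|[]].
by apply/negP => /(dvdp_leq d0); rewrite leqNgt lt_size_deriv.
Qed.

Lemma exists_prime_divisor P :
  (1 < size P)%N -> exists2 Q, prime_poly Q & Q %| P.
Proof.
have [m] := ubnP (size P); elim: m P => // m IHm P; rewrite ltnS => Pm P1.
have P0 : P != 0 by rewrite -size_poly_gt0 ltnW.
have [[S [SP S1 SPne]]|noS] :=
    pselect (exists S, [/\ S %| P, (1 < size S)%N & size S != size P]).
  have SltP : (size S < size P)%N by rewrite ltn_neqAle SPne dvdp_leq.
  have [Q pQ QS] := IHm S (leq_trans SltP Pm) S1.
  by exists Q => //; apply: dvdp_trans SP.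
have zP : zprimitive P %| P.
  by rewrite {2}[P]zpolyEprim dvdpZr ?dvdpp // zcontents_eq0.
exists (zprimitive P) => //; split; first by rewrite zcontents_primitive P0.
  by rewrite size_zprimitive.
move=> S SP S1; rewrite size_zprimitive; apply/eqP/negP => /negP SPne.
by apply: noS; exists S; split=> //; apply: dvdp_trans zP.
Qed.

Lemma prime_factorization P : P != 0 ->
  exists c s, [/\ c != 0, P = c *: \prod_(Q <- s) Q &
                  forall Q, Q \in s -> prime_poly Q].
Proof.
have [m] := ubnP (size P); elim: m P => // m IHm P; rewrite ltnS => Pm P0.
have [P1|/exists_prime_divisor[Q pQ QP]] := leqP (size P) 1.
  exists P`_0, [::]; rewrite big_nil alg_polyC -size1_polyC //; split=> //.
  by apply: contraNneq P0 => P00; rewrite [P]size1_polyC // P00.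
have [Q1 sQ _] := pQ; have [r PE] := dvdpP_int QP.
rewrite zprimitive_id1 // in PE.
have /andP[Q0 r0] : (Q != 0) && (r != 0) by rewrite -negb_or -mulf_eq0 -PE.
have rlt : (size r < m)%N.
  apply: leq_trans Pm; rewrite PE size_mul //.
  by case: (size Q) sQ => [|[|a]] //= _; rewrite addSn ltnS leq_addl.
have [c [s [c0 rE ps]]] := IHm r rlt r0.
exists c, (Q :: s); rewrite big_cons PE rE -scalerAr; split=> // S.
by rewrite inE => /predU1P[->|/ps].
Qed.

End IntegerPolynomials.

(** * Heights *)

Section Heights.
Implicit Types P Q S : {poly int}.

Lemma coef_le_height P (i : nat) : (`|(P`_i)%R| <= poly_height P)%N.
Proof.
have [iP|iP] := ltnP i (size P); last by rewrite nth_default.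
exact: (@bigop.leq_bigmax _ (fun i : 'I_(size P) => `|(P`_i)%R|%N) (Ordinal iP)).
Qed.

Lemma exists_coef_height P : P != 0 ->
  exists i : nat, poly_height P = `|(P`_i)%R|%N.
Proof.
move=> P0; have P1 : (0 < #|'I_(size P)|)%N by rewrite card_ord size_poly_gt0.
have [i hi] := @bigop.eq_bigmax _ (fun i : 'I_(size P) => `|(P`_i)%R|%N) P1.
by exists i; rewrite -hi.
Qed.

Lemma height_gt0 P : P != 0 -> (0 < poly_height P)%N.
Proof.
move=> P0; apply: leq_trans (coef_le_height P (size P).-1).
by rewrite -lead_coefE absz_gt0 lead_coef_eq0.
Qed.

(** The closed field [K] serves to split [P] into linear factors. *)
Lemma height_mul_le (K : numClosedFieldType) (n : nat) P Q :
    (size (P * Q)%R <= n.+1)%N -> P * Q != 0 ->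
  (poly_height P * poly_height Q <= (2 * n) ^ n * poly_height (P * Q)%R)%N.
Proof.
move=> sz PQ0; move: (PQ0); rewrite mulf_eq0 negb_or => /andP[P0 Q0].
have [i ->] := exists_coef_height P0; have [j ->] := exists_coef_height Q0.
pose toK := map_poly intr : {poly int} -> {poly K}.
have size_toK S : size (toK S) = size S by rewrite size_map_inj_poly //; exact: intr_inj.
have coef_toK S l : `|(toK S)`_l| = (`|(S`_l)%R|%N)%:R.
  by rewrite coef_map /= -intr_norm -natr_absz.
have [s PE] := closed_field_poly_normal (toK P).
have := @coef_mul_prod_XsubC_bound K n s (lead_coef (toK P)) (poly_height (P * Q))%:R (toK Q).
rewrite /= -PE -rmorphM /= => /(_ _ _ i j).
rewrite size_toK !coef_toK -natrM -natrX -natrM ler_nat => h.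
apply: leq_trans (h sz _) _ => [l|]; first by rewrite coef_toK ler_nat coef_le_height.
rewrite leq_mul2r; apply/orP; right.
have sn : (size s <= n)%N.
  rewrite -ltnS (leq_trans _ sz) //.
  have -> : (size s).+1 = size P.
    rewrite -size_toK PE size_scale ?size_prod_XsubC //.
    by rewrite lead_coef_eq0 -size_poly_gt0 size_toK size_poly_gt0.
  by rewrite size_mul // -[size Q]prednK ?size_poly_gt0 // addnS leq_addr.
case: n sz h sn => [|n] _ _ sn; first by rewrite leqn0 in sn; rewrite (eqP sn).
by rewrite leq_pexp2l.
Qed.

End Heights.

(** * Logarithmic heights and values *)

Section Logarithmic.
Variables (R : realType) (xi : R).
Hypothesis hxi : transcendental xi.
Implicit Types P Q S : {poly int}.

Definition log_height P : R := ln (poly_height P)%:R.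
Definition log_val P : R := ln (poly_val xi P).

Lemma log_height_ge0 P : P != 0 -> 0 <= log_height P.
Proof. by move=> P0; rewrite ln_ge0 // ler1n height_gt0. Qed.

Lemma map_ratr_intr (F : numFieldType) P :
  map_poly (ratr : rat -> F) (map_poly intr P) = map_poly intr P.
Proof. by rewrite -map_poly_comp; apply: eq_map_poly => z; rewrite /= ratr_int. Qed.

Lemma poly_val_gt0 P : P != 0 -> 0 < poly_val xi P.
Proof.
move=> P0; rewrite /poly_val normr_gt0; apply/eqP => Pxi; apply: hxi.
exists (map_poly intr P); last by rewrite map_ratr_intr; apply/rootP.
by rewrite map_poly_eq0_id0 // intr_eq0 lead_coef_eq0.
Qed.

Lemma poly_valM P Q : poly_val xi (P * Q) = poly_val xi P * poly_val xi Q.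
Proof. by rewrite /poly_val rmorphM /= hornerM normrM. Qed.

Lemma log_valM P Q : P != 0 -> Q != 0 -> log_val (P * Q) = log_val P + log_val Q.
Proof. by move=> P0 Q0; rewrite /log_val poly_valM lnM // posrE poly_val_gt0. Qed.

Lemma log_val_const_ge0 (c : int) : c != 0 -> 0 <= log_val c%:P.
Proof.
move=> c0; rewrite ln_ge0 // /poly_val map_polyC /= hornerC.
exact: (norm_int_ge1 R c0).
Qed.

Lemma prod_neq0 (s : seq {poly int}) :
  (forall Q, Q \in s -> Q != 0) -> \prod_(Q <- s) Q != 0.
Proof. by move=> s0; rewrite prodf_seq_neq0; apply/allP => Q /s0. Qed.

Lemma sum_log_val_le (c : int) (s : seq {poly int}) : c != 0 ->
  (forall Q, Q \in s -> Q != 0) ->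
  \sum_(Q <- s) log_val Q <= log_val (c *: \prod_(Q <- s) Q).
Proof.
move=> c0 s0; have -> : \sum_(Q <- s) log_val Q = log_val (\prod_(Q <- s) Q).
  elim: s s0 => [_|Q s IHs s0].
    by rewrite !big_nil /log_val /poly_val rmorph1 hornerC normr1 ln1.
  have s0' S : S \in s -> S != 0 by move=> Ss; rewrite s0 // inE Ss orbT.
  by rewrite !big_cons log_valM ?IHs // ?prod_neq0 // s0 ?mem_head.
rewrite -mul_polyC log_valM ?polyC_eq0 ?prod_neq0 //.
by rewrite lerDr log_val_const_ge0.
Qed.

(** Iterated Gelfond inequality: each factor costs one constant. *)
Lemma sum_log_height_le (n : nat) (c : int) (s : seq {poly int}) : c != 0 ->
  (forall Q, Q \in s -> Q != 0) ->
  (size (c *: \prod_(Q <- s) Q)%R <= n.+1)%N ->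
  \sum_(Q <- s) log_height Q <=
    (size s)%:R * ln ((2 * n) ^ n)%:R + log_height (c *: \prod_(Q <- s) Q).
Proof.
move=> c0; elim: s => [s0 _|Q s IHs s0].
  by rewrite !big_nil mulr0n mul0r add0r log_height_ge0 // alg_polyC polyC_eq0.
have s0' S : S \in s -> S != 0 by move=> Ss; rewrite s0 // inE Ss orbT.
have Q0 : Q != 0 by rewrite s0 ?mem_head.
rewrite !big_cons scalerAr; set T := c *: _ in IHs *; move=> sz.
have T0 : T != 0 by rewrite /T -mul_polyC mulf_neq0 ?polyC_eq0 ?prod_neq0.
have QT0 : Q * T != 0 by rewrite mulf_neq0.
have szT : (size T <= n.+1)%N.
  by apply: leq_trans sz; rewrite dvdp_leq // dvdp_mulIr.
have h := @height_mul_le R[i] n Q T sz QT0.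
have : log_height Q + log_height T <= ln ((2 * n) ^ n)%:R + log_height (Q * T).
  have pos S : S != 0 -> (poly_height S)%:R \is @Num.pos R.
    by move=> S0; rewrite posrE ltr0n height_gt0.
  have Kpos : ((2 * n) ^ n)%:R \is @Num.pos R.
    rewrite posrE ltr0n lt0n; apply: contraTneq h => ->.
    by rewrite mul0n -ltnNge muln_gt0 !height_gt0.
  rewrite /log_height -!lnM ?pos // ler_ln ?posrE ?mulr_gt0 -?posrE ?pos //.
  by rewrite -!natrM ler_nat.
have := IHs s0' szT; rewrite /= mulrSr mulrDl mul1r; lra.
Qed.

(** Two coprime integer polynomials cannot both be small at [xi] relative to
    their heights.  The alternative says which of the two relative values is
    the larger one. *)
Lemma resultant_log_bound (n : nat) : exists2 c : R, 0 <= c &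
  forall Q S, coprimep Q S -> (1 < size Q <= n.+1)%N ->
    S != 0 -> (size S <= n.+1)%N ->
  let common := c + (size S).-1%:R * log_height Q + (size Q).-1%:R * log_height S in
  0 <= common + log_val Q - log_height Q \/ 0 <= common + log_val S - log_height S.
Proof.
pose b := (Num.truncn `|xi|).+1.
have xib : `|xi| <= b%:R by apply/ltW/truncnS_gt.
exists (ln ((n + n)`! * b ^ n)%:R).
  by rewrite ln_ge0 // ler1n muln_gt0 fact_gt0 expn_gt0.
move=> Q S cop sQ S0 sS /=.
have Q0 : Q != 0 by rewrite -size_poly_gt0; case/andP: sQ => /ltnW.
pose v P := poly_val xi P / (poly_height P)%:R.
have v0 P : P != 0 -> 0 < v P by move=> P0; rewrite divr_gt0 ?poly_val_gt0 // ltr0n height_gt0.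
have sS' : (0 < size S <= n.+1)%N by rewrite size_poly_gt0 S0.
have vE P : P != 0 -> v P * (poly_height P)%:R = poly_val xi P.
  by move=> P0; rewrite divfK // pnatr_eq0 -lt0n height_gt0.
have main d : v Q <= d -> v S <= d -> 0 < d ->
    0 <= ln ((n + n)`! * b ^ n)%:R + (size S).-1%:R * log_height Q
         + (size Q).-1%:R * log_height S + ln d.
  move=> vQ vS d0.
  have hQ : `|(map_poly intr Q : {poly R}).[xi]| <= d * (poly_height Q)%:R.
    by rewrite -/(poly_val xi Q) -vE // ler_wpM2r.
  have hS : `|(map_poly intr S : {poly R}).[xi]| <= d * (poly_height S)%:R.
    by rewrite -/(poly_val xi S) -vE // ler_wpM2r.
  have := resultant_lower_bound cop sQ sS' (ltn0Sn _) xib (coef_le_height Q)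
            (coef_le_height S) hQ hS (ltW d0).
  rewrite -/b => le1; have := ln_ge0 le1.
  rewrite !natrM !natrX => /le_trans; apply.
  have HQ : 0 < (poly_height Q)%:R :> R by rewrite ltr0n height_gt0.
  have HS : 0 < (poly_height S)%:R :> R by rewrite ltr0n height_gt0.
  have C0 : 0 < (n + n)`!%:R * b%:R ^+ n :> R.
    by rewrite mulr_gt0 ?exprn_gt0 // ltr0n fact_gt0.
  rewrite !lnM ?posrE ?mulr_gt0 ?exprn_gt0 // !lnXn // !mulr_natl.
  by rewrite lexx.
have lv P : P != 0 -> ln (v P) = log_val P - log_height P.
  by move=> P0; rewrite ln_div // posrE ?poly_val_gt0 // ltr0n height_gt0.
have [QS|/ltW SQ] := leP (v Q) (v S).
  by right; rewrite -addrA -lv // main ?v0.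
by left; rewrite -addrA -lv // main ?v0.
Qed.

End Logarithmic.

(** * Algebraic numbers close to a real number *)

Section AlgebraicNumbers.
Variables (R : realType).
Implicit Types (P Q S : {poly int}) (a : R[i]).

Local Notation "P ^C" := (map_poly intr P : {poly R[i]}) (at level 1, format "P ^C").

Lemma norm_complexE (z : R[i]) : `|z| = (ComplexField.Normc.normc z)%:C%C.
Proof. by []. Qed.

Lemma norm_real_complex (x : R) : `|x%:C%C| = (`|x|)%:C%C.
Proof. by rewrite normc_def /= expr0n addr0 sqrtr_sqr. Qed.

Lemma horner_real_complex P (x : R) :
  P^C.[x%:C%C] = ((map_poly intr P : {poly R}).[x])%:C%C.
Proof.
have -> : P^C = map_poly (real_complex R) (map_poly intr P).
  by rewrite -map_poly_comp; apply: eq_map_poly => z /=; rewrite rmorph_int.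
by rewrite horner_map.
Qed.

Lemma norm_horner_real_complex P (x : R) :
  `|P^C.[x%:C%C]| = (poly_val x P)%:C%C.
Proof. by rewrite horner_real_complex norm_real_complex. Qed.

Lemma natr_complex (k : nat) : k%:R = (k%:R : R)%:C%C :> R[i].
Proof. by rewrite rmorph_nat. Qed.

Lemma map_int_poly_neq0 P : P != 0 -> P^C != 0.
Proof. by move=> P0; rewrite map_poly_eq0_id0 // intr_eq0 lead_coef_eq0. Qed.

Lemma prime_poly_dvdp_root Q S a :
  prime_poly Q -> root Q^C a -> root S^C a -> Q %| S.
Proof.
move=> pQ /rootP Qa /rootP Sa; apply: contraT => /(prime_poly_coprime pQ).
move=> /Bezout_coprimepP[[u v] /= uv1].
have /size_poly1P[c c0 cE] : size (u * Q + v * S) == 1%N.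
  by rewrite (eqp_size uv1) size_poly1.
have := congr1 (fun p => (map_poly intr p : {poly R[i]}).[a]) cE.
rewrite /= rmorphD !rmorphM /= map_polyC hornerD !hornerM Qa Sa !mulr0 addr0.
by rewrite hornerC => /esym/eqP; rewrite intr_eq0 (negPf c0).
Qed.

Lemma int_minpoly_prime Q a : prime_poly Q -> root Q^C a -> int_minpoly a = Q.
Proof.
move=> pQ Qa; have [Q1 _ _] := pQ; rewrite /int_minpoly.
have Qmin : is_int_minpoly a Q.
  by split=> // S S0 Sa; apply: dvdp_leq => //; apply: prime_poly_dvdp_root Sa.
have [P1 Pa Pmin] := @xgetPex _ 0 [set P | is_int_minpoly a P] (ex_intro _ Q Qmin).
apply: primitive_dvdp_eq => //; first exact: prime_poly_dvdp_root Pa.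
by apply: Pmin => //; apply: prime_poly_neq0.
Qed.

Lemma algebraic_number_root P a : P != 0 -> root P^C a -> algebraic_number a.
Proof.
move=> P0 Pa; exists (map_poly intr P); last by rewrite map_ratr_intr.
by rewrite map_poly_eq0_id0 // intr_eq0 lead_coef_eq0.
Qed.

Lemma algebraic_number_prime a :
  algebraic_number a -> exists2 Q, prime_poly Q & root Q^C a.
Proof.
move=> [p p0 pa]; have [P [d d0 pE]] := rat_poly_scale p.
have Pa : root P^C a.
  move: pa; rewrite pE map_polyZ map_ratr_intr rootZ // fmorph_eq0 invr_eq0 intr_eq0 //.
have P0 : P != 0.
  by apply: contraNneq p0 => P0; rewrite pE P0 rmorph0 scaler0.
have [c [s [c0 PE ps]]] := prime_factorization P0.
move: Pa; rewrite PE map_polyZ rootZ ?intr_eq0 // rmorph_prod /root horner_prod.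
rewrite prodf_seq_eq0 => /hasP[Q Qs /= Qa].
by exists Q => //; apply: ps.
Qed.

Lemma alg_val_gt0 (xi : R) a :
  transcendental xi -> algebraic_number a -> 0 < alg_val xi a.
Proof.
move=> hxi /algebraic_number_prime[Q pQ Qa]; have Q0 := prime_poly_neq0 pQ.
rewrite /alg_val /alg_height (int_minpoly_prime pQ Qa) mulr_gt0 ?ltr0n ?height_gt0 //.
rewrite -ltcR -norm_complexE normr_gt0 subr_eq0; apply: contraTneq Qa => <-.
rewrite /root horner_real_complex -[0]/(0%:C%C) (inj_eq (@complexI _)).
by have := poly_val_gt0 hxi Q0; rewrite /poly_val normr_gt0.
Qed.

(** The passage from a small irreducible polynomial to a close algebraic number
    loses only the exponent [(size Q).-2] of the height, one less than the
    degree. *)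
Lemma near_root_log (n : nat) (xi : R) : transcendental xi ->
  exists c : R, forall Q, prime_poly Q -> (size Q <= n.+1)%N -> log_val xi Q < 0 ->
  exists a, [/\ algebraic_number a, int_minpoly a = Q &
    ln (alg_val xi a) <= c + log_val xi Q + (size Q).-2%:R * log_height R Q].
Proof.
move=> hxi; pose b := (Num.truncn `|xi|).+2.
have xib : `|xi| + 1 <= b%:R by rewrite /b mulrSr lerD2r; apply/ltW/truncnS_gt.
pose C1 := ((n + n)`! * (n * b ^ n * (b + 2)) ^ 2 * (2 * n) ^ (n + n))%N.
pose C := (b + 2 ^ n * C1)%N.
have C0 : (0 < C)%N by [].
exists (ln C%:R) => Q pQ sQn lQ0; have [Q1 sQ _] := pQ; have Q0 := prime_poly_neq0 pQ.
have vQ := poly_val_gt0 hxi Q0.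
have vQ1 : poly_val xi Q < 1.
  by rewrite ltNge; apply/negP => /ln_ge0; rewrite leNgt -/(log_val xi Q) lQ0.
have szC : size Q^C = size Q by rewrite size_map_inj_poly //; exact: intr_inj.
have := @near_root _ Q^C xi%:C%C; rewrite szC norm_horner_real_complex.
move=> /(_ sQ)[a [Qa far near lin]].
have leadC : lead_coef Q^C = (lead_coef Q)%:~R.
  by rewrite lead_coef_map_inj //; exact: intr_inj.
have lead1 : 1 <= `|lead_coef Q^C| by rewrite leadC norm_int_ge1 // lead_coef_eq0.
have close : `|xi%:C%C - a| <= 1.
  case: (real_leP (normr_real (xi%:C%C - a)) (@real1 R[i])) => // /ltW gt1.
  have : 1 <= (poly_val xi Q)%:C%C.
    by apply: le_trans far; rewrite mulr_ege1 // exprn_ege1.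
  by move=> q1; have := le_lt_trans (_ : 1 <= poly_val xi Q) vQ1; rewrite ltxx -lecR => /(_ q1).
have ab : `|a| <= b%:R.
  have -> : a = xi%:C%C - (xi%:C%C - a) by ring.
  apply: le_trans (ler_normB _ _) _; rewrite norm_real_complex.
  apply: le_trans (_ : (`|xi| + 1)%:C%C <= _).
    by rewrite rmorphD /= lerD2l.
  by rewrite natr_complex lecR.
exists a; split; first exact: algebraic_number_root Qa.
  exact: int_minpoly_prime.
rewrite /alg_val /alg_height (int_minpoly_prime pQ Qa).
set H := poly_height Q; have H0 : (0 < H)%N by apply: height_gt0.
set t := ComplexField.Normc.normc _.
have tE : `|xi%:C%C - a| = t%:C%C by rewrite norm_complexE.
have t0 : 0 < t.
  have := alg_val_gt0 hxi (algebraic_number_root Q0 Qa).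
  by rewrite /alg_val -/t pmulr_rgt0 // /alg_height (int_minpoly_prime pQ Qa) ltr0n.
suff bound : H%:R * t <= C%:R * poly_val xi Q * H%:R ^+ (size Q).-2.
  rewrite /log_val /log_height -/H.
  have -> : (size Q).-2%:R * ln H%:R = ln (H%:R ^+ (size Q).-2) :> R.
    by rewrite lnXn ?ltr0n // mulr_natl.
  rewrite -!lnM ?posrE ?mulr_gt0 ?exprn_gt0 ?ltr0n //.
  by rewrite ler_ln ?posrE ?mulr_gt0 ?exprn_gt0 ?ltr0n.
(* A linear Q has no discriminant to use; then H is comparable with the
   leading coefficient because the root is bounded. *)
have [Q2|Q3] : size Q = 2%N \/ (2 < size Q)%N.
  by move: sQ; rewrite leq_eqVlt => /predU1P[->|]; [left|right].
  rewrite Q2 expr0 mulr1; have QE := lin Q2; move: far near.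
  rewrite Q2 expr1 tE => far _.
  have Hlead : H%:R <= b%:R * `|lead_coef Q^C|.
    have [i Hi] := exists_coef_height Q0.
    have -> : H%:R = `|Q^C`_i| by rewrite /H Hi coef_map /= -intr_norm -natr_absz.
    rewrite QE coefZ normrM [leRHS]mulrC lead_coefZ lead_coefXsubC mulr1 ler_wpM2l //.
    rewrite coefB coefX coefC; case: i {Hi} => [|[|i]] /=.
    - by rewrite sub0r normrN.
    - by rewrite subr0 normr1 ler1n.
    - by rewrite subr0 normr0.
  rewrite -lecR !rmorphM /= -!natr_complex.
  apply: le_trans (_ : b%:R * (poly_val xi Q)%:C%C <= _); last first.
    by apply: ler_wpM2r; rewrite ?ler_nat ?leq_addr // ler0c ltW.
  apply: le_trans (ler_wpM2l _ far) => //.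
  rewrite mulrCA [leLHS]mulrC; apply: ler_wpM2l => //.
  by rewrite ler0c ltW.
have cop := prime_poly_separable pQ.
have := @deriv_root_lower_bound R[i] n b H a Q cop _ (ltn0Sn _) ab (coef_le_height Q) Qa.
rewrite Q3 => /(_ sQn); rewrite -/C1; set y := `|Q^C^`().[a]| in near * => le1.
have C10 : (0 < C1)%N.
  by rewrite lt0n; apply: contraTneq le1 => ->; rewrite mul0n mul0r ler10.
have y0 : 0 <= y by rewrite normr_ge0.
have {le1} le1 : 1 <= (C1 * H ^ (size Q - 3))%:R * y.
  rewrite -[1 <= _](@ler_sqr _ 1) ?nnegrE ?mulr_ge0 //.
  rewrite expr1n (le_trans le1) // [leRHS]exprMn.
  apply: ler_wpM2r; first by rewrite exprn_ge0.
  rewrite -natrX ler_nat expnMn -expnM leq_mul2r; apply/orP; right.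
  by rewrite -mulnn leq_pmulr.
rewrite -lecR !rmorphM rmorphXn /= -!natr_complex -tE.
set q := (poly_val xi Q)%:C%C in near *.
have q0 : 0 <= q by rewrite ler0c ltW.
apply: le_trans (_ : H%:R * ((C1 * H ^ (size Q - 3))%:R * (2%:R ^+ (size Q).-1 * q)) <= _).
  apply: ler_wpM2l => //; apply: le_trans (ler_wpM2l _ near) => //.
  by rewrite mulrCA ler_peMr.
have -> : (size Q).-2 = (size Q - 3).+1 by move: Q3; case: (size Q) => [|[|[|k]]] //= _; rewrite !subSS subn0.
rewrite [leRHS]mulrAC exprS !mulrA; apply: ler_wpM2r => //.
rewrite -!natrX -!natrM ler_nat.
set X := (H ^ _)%N; set E := (2 ^ (size Q).-1)%N.
have -> : (H * (C1 * X) * E = E * C1 * (H * X))%N by ring.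
rewrite -[leqRHS]mulnA leq_mul // /C (leq_trans _ (leq_addl _ _)) // leq_mul //.
by rewrite leq_pexp2l // -ltnS prednK // ltnW.
Qed.

End AlgebraicNumbers.

(** * Finiteness, minimizers and lower limits *)

(** The coefficients are shifted by [B], so that natural numbers up to [2 B]
    encode all integers from [- B] to [B]. *)
Definition bounded_polys (n B : nat) : seq {poly int} :=
  [seq \poly_(i < n.+1) ((t (inord i) : nat)%:Z - B%:Z)
    | t : {ffun 'I_n.+1 -> 'I_(B + B).+1} <- enum {ffun 'I_n.+1 -> 'I_(B + B).+1}].

Lemma mem_bounded_polys (n B : nat) (P : {poly int}) :
  (size P <= n.+1)%N -> (poly_height P <= B)%N -> P \in bounded_polys n B.
Proof.
move=> sP hP; apply/mapP.
exists [ffun i : 'I_n.+1 => inord `|(P`_i + B%:Z)%R|%N]; first by rewrite mem_enum.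
apply/polyP => i; rewrite coef_poly; case: ltnP => [ni|/(leq_trans sP)]; last first.
  exact: nth_default.
have := leq_trans (coef_le_height P i) hP.
rewrite ffunE (inordK ni); move: (P`_i) => z zB.
by rewrite inordK; lia.
Qed.

Lemma log_val_lower_bound (R : realType) (xi : R) (n : nat) (B : R) :
  exists L, forall P : {poly int}, (size P <= n.+1)%N -> log_height R P <= B ->
    P != 0 -> L <= log_val xi P.
Proof.
pose N := Num.truncn (expR B).
exists (- \sum_(P <- bounded_polys n N) `|log_val xi P|) => P sP hP P0.
have PN : P \in bounded_polys n N.
  apply: mem_bounded_polys => //; rewrite /N truncn_ge_nat ?expR_ge0 //.
  by rewrite -ler_ln ?posrE ?expR_gt0 ?ltr0n ?height_gt0 // expRK.
rewrite lerNl (big_rem P) //=; apply: le_trans (_ : `|log_val xi P| <= _).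
  by rewrite -normrN ler_norm.
by rewrite lerDl sumr_ge0.
Qed.

(** The minimum is attained because the admissible numbers are among the roots
    of finitely many polynomials. *)
Lemma best_algP (R : realType) (n : nat) (xi X : R) (a : R[i]) :
  alg_admissible n X a ->
  alg_admissible n X (best_alg n xi X) /\
  (forall b, alg_admissible n X b -> alg_val xi (best_alg n xi X) <= alg_val xi b).
Proof.
move=> adm_a.
pose roots_of (P : {poly int}) : seq R[i] :=
  sval (closed_field_poly_normal (map_poly intr P : {poly R[i]})).
pose cand := [seq b <- flatten [seq roots_of P | P <- bounded_polys n (Num.truncn X)]
                | `[< alg_admissible n X b >]].
have candP b : (b \in cand) = `[< alg_admissible n X b >].
  rewrite mem_filter; case: asboolP => //= -[alg_b deg_b hgt_b].
  have [Q pQ Qb] := algebraic_number_prime alg_b.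
  have QE := int_minpoly_prime pQ Qb; have Q0 := prime_poly_neq0 pQ.
  apply/flatten_mapP; exists Q.
    apply: mem_bounded_polys.
      move: deg_b; rewrite /alg_degree QE => deg_b.
      by rewrite -[size Q]prednK ?size_poly_gt0.
    rewrite truncn_ge_nat; first by rewrite -QE.
    exact: le_trans hgt_b.
  rewrite /roots_of; case: closed_field_poly_normal => r /= rE.
  move: Qb; rewrite rE rootZ ?root_prod_XsubC //.
  by rewrite lead_coef_eq0 map_int_poly_neq0.
have cand0 : cand != [::].
  by apply/eqP => c0; have := candP a; rewrite c0 in_nil; case: asboolP.
have [b] := exists_min_seq (fun b => num_real (alg_val xi b)) cand0.
rewrite candP => /asboolP adm_b bmin; rewrite /best_alg.
apply: (@xgetPex _ 0 [set a | alg_admissible n X a /\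
  forall b, alg_admissible n X b -> alg_val xi a <= alg_val xi b]).
by exists b; split=> // c adm_c; apply: bmin; rewrite candP; apply/asboolP.
Qed.

Lemma wstar_at_ge (R : realType) (n : nat) (xi X v : R) (a : R[i]) :
    transcendental xi -> 1 < X -> alg_admissible n X a ->
    ln (alg_val xi a) <= - (v * ln X) ->
  v <= wstar_at n xi X.
Proof.
move=> hxi X1 adm_a vX; have lnX := ln_gt0 X1.
have [[alg_b _ _] bmin] := best_algP xi adm_a.
have [alg_a _ _] := adm_a.
rewrite /wstar_at -mulNr ler_pdivlMr // lerNr.
by apply: le_trans vX; rewrite ler_ln ?posrE ?alg_val_gt0 // bmin.
Qed.

(** If there were no minimizer, the default value [0] would make [w_at] equal to
    [0], as [ln 0 = 0]; so a value above [w >= 0] comes from a true minimizer. *)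
Lemma poly_of_w_at_gt (R : realType) (n : nat) (xi X w : R) :
    transcendental xi -> 1 < X -> 0 <= w -> w < w_at n xi X ->
  exists P : {poly int}, [/\ P != 0, (size P <= n.+1)%N,
    log_height R P <= ln X & log_val xi P <= - (w * ln X)].
Proof.
move=> hxi X1 w0 wX; have lnX := ln_gt0 X1; move: wX; rewrite /w_at /best_poly.
case: xgetP => [P _ [[P0 sP hP] _]|_]; last first.
  by rewrite /poly_val rmorph0 horner0 normr0 ln0 // mul0r oppr0 ltNge w0.
rewrite -mulNr ltr_pdivlMr // => wX; exists P; split=> //.
  rewrite /log_height ler_ln ?posrE ?ltr0n ?height_gt0 //.
  exact: lt_trans X1.
by rewrite lerNr ltW.
Qed.

Section Limits.
Variables (R : realType) (f : R -> R).
Local Open Scope ereal_scope.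

Lemma limf_einf_gt (w : R) :
  w%:E < limf_einf (fun X : R => (f X)%:E) (pinfty_nbhs R) ->
  \forall X \near +oo%R, (w < f X)%R.
Proof.
rewrite limf_einfE => /ereal_sup_gt[_ [V FV <-]] wV.
apply: filterS FV => X VX; rewrite -lte_fin.
by apply: lt_le_trans wV _; apply: ereal_inf_lbound; exists X.
Qed.

Lemma limf_einf_ge (v : R) :
  (\forall X \near +oo%R, (v <= f X)%R) ->
  v%:E <= limf_einf (fun X : R => (f X)%:E) (pinfty_nbhs R).
Proof.
move=> vf; rewrite limf_einfE.
apply: le_trans (_ : ereal_inf ((fun X : R => (f X)%:E) @` [set X | (v <= f X)%R]) <= _).
  by apply: le_ereal_inf_tmp => _ [X vX <-]; rewrite lee_fin.
by apply: ereal_sup_ubound; exists [set X | (v <= f X)%R].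
Qed.

End Limits.

(** * The dominant factor of a small polynomial *)

Lemma sum_count_mem (T : eqType) (R : pzRingType) (F : T -> R) (a : T) (s : seq T) :
  \sum_(x <- s) F x = (count_mem a s)%:R * F a + \sum_(x <- s | x != a) F x.
Proof.
elim: s => [|x s IHs]; first by rewrite !big_nil mul0r addr0.
rewrite !big_cons IHs /=; case: eqP => [->|_] /=.
  by rewrite natrD mulrDl mul1r addrA.
by rewrite add0n addrCA.
Qed.

Lemma sum_degree_prod (s : seq {poly int}) (c : int) : c != 0 ->
  (forall Q, Q \in s -> Q != 0) ->
  (\sum_(Q <- s) (size Q).-1 = (size (c *: \prod_(Q <- s) Q)%R).-1)%N.
Proof.
move=> c0; rewrite size_scale //; elim: s => [|Q s IHs] s0.
  by rewrite !big_nil size_poly1.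
have s0' S : S \in s -> S != 0 by move=> Ss; rewrite s0 // inE Ss orbT.
have Q0 : Q != 0 by rewrite s0 ?mem_head.
rewrite !big_cons IHs // size_mul ?prod_neq0 //.
have := prod_neq0 s0'; rewrite -size_poly_gt0 => /prednK <-.
by rewrite -[size Q]prednK ?size_poly_gt0 //= addnS.
Qed.

(** In this lemma and the next ones, [D] is the degree of the dominant factor
    minus one, [d] the degree of another factor, and [hQ], [lQ], [hS], [lS] are
    logarithmic heights and values. *)
Lemma other_factor_arith (R : realFieldType) (D d hQ lQ hS lS c : R) :
    0 <= c -> 1 <= d -> lQ - hQ <= lS - hS ->
    0 <= c + d * hQ + (D + 1) * hS + lQ - hQ \/
    0 <= c + d * hQ + (D + 1) * hS + lS - hS ->
  - ((c + hQ) * d) - D * hS <= lS.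
Proof.
move=> c0 d1 lmin res; have cd : c <= c * d by rewrite ler_peMr.
by case: res => ?; lra.
Qed.

Lemma dominant_factor_arith (R : realFieldType)
    (m D hQ lQ dT hT lT n x c lP : R) :
    0 <= m -> 0 <= D -> 0 <= hQ -> 0 <= c ->
    m * (D + 1) + dT <= n -> m * hQ + hT <= x -> m * lQ + lT <= lP ->
    - ((c + hQ) * dT) - D * hT <= lT ->
  m * (lQ + D * hQ) <= n * c + lP + D * x + (n - m * (D + 1)) * hQ.
Proof.
move=> m0 D0 h0 c0 dTn hTx lTP low.
have t1 : (c + hQ) * dT <= (c + hQ) * (n - m * (D + 1)).
  by rewrite ler_wpM2l ?addr_ge0 // lerBrDl.
have t2 : D * hT <= D * (x - m * hQ) by rewrite ler_wpM2l // lerBrDl.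
have t3 : 0 <= c * (m * (D + 1)) by rewrite !mulr_ge0 // addr_ge0.
lra.
Qed.

(** Multiply the last hypothesis by [m] and use [m * hQ <= x]: up to
    constants the result exceeds what is wanted by
    [(m - 1) * (m * w - (m * n + n - m)) * x], which the sign condition
    discards. *)
Lemma single_factor_arith (R : realFieldType) (m D w n x hQ eQ c : R) :
    1 <= m -> 0 <= D -> 0 <= x -> 0 <= c ->
    m * (D + 1) <= n -> m * hQ <= x ->
    (m - 1) * (m * w - (m * n + n - m)) <= 0 ->
    m * eQ <= c - (w - D) * x + (n - m * (D + 1)) * hQ ->
  eQ <= c - (w - n + 1) * x.
Proof.
move=> m1 D0 x0 c0 mDn mhx caseA star.
have m0 : 0 < m by apply: lt_le_trans m1.
have t1 : (n - m * (D + 1)) * (m * hQ) <= (n - m * (D + 1)) * x.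
  by rewrite ler_wpM2l // subr_ge0.
have t2 : m * (m * eQ) <= m * (c - (w - D) * x + (n - m * (D + 1)) * hQ).
  by rewrite ler_wpM2l // ltW.
have t3 : (m - 1) * (m * w - (m * n + n - m)) * x <= 0 by rewrite mulr_le0_ge0.
have t4 : 0 <= m * (m - 1) * c by rewrite !mulr_ge0 ?subr_ge0 // ltW.
rewrite -(ler_pM2l m0) -(ler_pM2l m0); lra.
Qed.

(** In the first case of the disjunction [lQ] is bounded below by a multiple of
    [hQ], in the second [lS] is; either bound is compared with the upper bound
    for the same quantity among the hypotheses. *)
Lemma repeated_factor_arith (R : realFieldType) (m D w n x hQ lQ hS lS c c1 k s : R) :
    1 <= m -> 0 <= D -> 0 <= c -> 0 <= c1 -> 0 <= k -> 0 <= w -> 0 <= hQ -> 0 <= s ->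
    m * (D + 1) <= n -> m * hQ <= x -> n - 1 < w -> D + 1 <= n -> s <= n ->
    m * (lQ + D * hQ) <= c - (w - D) * x + (n - m * (D + 1)) * hQ ->
    hS <= hQ -> lS <= - (w * (hQ - k)) ->
    0 <= c1 + s * hQ + (D + 1) * hS + lQ - hQ \/
    0 <= c1 + s * hQ + (D + 1) * hS + lS - hS ->
  (m * w - (m * n + n - m)) * hQ <= c + m * c1 + m * (c1 + w * k).
Proof.
move=> m1 D0 c0 c10 k0 w0 h0 s0 mDn mhx wn Dn sn star hSQ lSk res.
have m0 : 0 < m by apply: lt_le_trans m1.
have u1 : s * hQ <= n * hQ by rewrite ler_wpM2r.
have u2 : D * hS <= D * hQ by rewrite ler_wpM2l.
have v1 : 0 <= m * c1 by rewrite mulr_ge0 // ltW.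
have v2 : 0 <= m * (w * k) by rewrite !mulr_ge0 // ltW.
case: res => res.
  have r : 0 <= m * (c1 + n * hQ + (lQ + D * hQ)) by apply: mulr_ge0; [exact: ltW | lra].
  have t : (w - D) * (m * hQ) <= (w - D) * x by rewrite ler_wpM2l //; lra.
  lra.
have r : 0 <= m * (c1 + n * hQ + D * hQ - w * (hQ - k)) by apply: mulr_ge0; [exact: ltW | lra].
have t : m * (D + 1) * hQ <= n * hQ by rewrite ler_wpM2r.
lra.
Qed.

Lemma bounded_factor_arith (R : realFieldType) (m D w n x hQ lQ c B L : R) :
    1 <= m -> 0 <= D -> 0 <= x -> 0 <= hQ -> n - 1 < w -> m * (D + 1) <= n ->
    hQ <= B -> L <= lQ ->
    m * (lQ + D * hQ) <= c - (w - D) * x + (n - m * (D + 1)) * hQ ->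
  x <= (c + n * `|B| + n * `|L|) / (w - n + 1).
Proof.
move=> m1 D0 x0 h0 wn mDn hB Ll star.
have m0 : 0 <= m by apply: le_trans m1.
have Dn : D + 1 <= n by apply: le_trans mDn; rewrite ler_peMl // addr_ge0.
have mn : m <= n by apply: le_trans mDn; rewrite ler_peMr // lerDr.
have a0 : 0 < w - n + 1 by lra.
rewrite ler_pdivlMr //.
have t1 : m * - `|L| <= m * lQ.
  by rewrite ler_wpM2l // (le_trans _ Ll) // lerNl -normrN ler_norm.
have t2 : m * `|L| <= n * `|L| by rewrite ler_wpM2r.
have t3 : 0 <= m * (D * hQ) by rewrite !mulr_ge0.
have t4 : (w - n + 1) * x <= (w - D) * x by rewrite ler_wpM2r //; lra.
have t5 : n * hQ <= n * `|B|.
  by rewrite ler_wpM2l ?(le_trans m0) // (le_trans hB) // ler_norm.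
have t6 : 0 <= m * (D + 1) * hQ by rewrite !mulr_ge0 // addr_ge0.
lra.
Qed.

Section MainEstimate.
Variables (R : realType) (xi : R) (n : nat).
Hypotheses (hxi : transcendental xi) (n_gt0 : (0 < n)%N).
Implicit Types P Q S : {poly int}.
Local Notation h := (log_height R).
Local Notation l := (log_val xi).
Local Notation deg Q := ((size Q).-1%:R : R).
Local Notation e Q := (l Q + (size Q).-2%:R * h Q).

Lemma prime_degE Q : prime_poly Q -> deg Q = (size Q).-2%:R + 1.
Proof. by case=> _ + _; case: (size Q) => [|[|d]] //= _; rewrite natr1. Qed.

(** The factor [Q] minimizing [l Q - h Q] carries the smallness of [P]: any
    other factor [S] satisfies the resultant inequality through its second
    branch, which bounds [l S] from below, and these lower bounds are
    subtracted from [l P]. *)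
Lemma exists_dominant_factor : exists c k : R, [/\ 0 <= c, 0 <= k &
  forall P x, P != 0 -> (size P <= n.+1)%N -> l P < 0 -> h P + k <= x ->
  exists Q (m : nat), [/\ prime_poly Q, (0 < m)%N, m%:R * deg Q <= n%:R,
    m%:R * h Q <= x &
    m%:R * e Q <= c + l P + (size Q).-2%:R * x + (n%:R - m%:R * deg Q) * h Q]].
Proof.
have [c1 c10 res] := resultant_log_bound hxi n.
set kappa : R := ln ((2 * n) ^ n)%:R.
have kappa0 : 0 <= kappa by rewrite ln_ge0 // ler1n expn_gt0 muln_gt0 n_gt0.
exists (n%:R * c1), (n%:R * kappa); split; rewrite ?mulr_ge0 // => P x P0 sP lP hP.
have [a [s [a0 PE ps]]] := prime_factorization P0.
have s0 Q : Q \in s -> Q != 0 by move=> /ps/prime_poly_neq0.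
have sne : s != [::].
  apply: contraTneq lP => sE; rewrite PE sE big_nil alg_polyC -leNgt.
  exact: log_val_const_ge0.
have [Q Qs Qmin] := exists_min_seq (fun S => num_real (l S - h S)) sne.
have pQ := ps _ Qs; have Q0 := s0 _ Qs.
pose m := count_mem Q s.
have degsN : (\sum_(S <- s) (size S).-1 <= n)%N.
  by rewrite (sum_degree_prod a0 s0) -PE; move: sP; case: (size P).
have degs : \sum_(S <- s) deg S <= n%:R by rewrite -natr_sum ler_nat.
have sizes : (size s <= n)%N.
  apply: leq_trans degsN; rewrite -sum1_size [leqLHS]big_seq [leqRHS]big_seq.
  by apply: leq_sum => S /ps[_ S1 _]; rewrite -subn1 subn_gt0.
have sumd := sum_count_mem (fun S => deg S) Q s.
have sumh := sum_count_mem (fun S => h S) Q s.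
have suml := sum_count_mem (fun S => l S) Q s.
have hsum : \sum_(S <- s) h S <= x.
  rewrite PE in sP; apply: le_trans (sum_log_height_le R a0 s0 sP) _.
  rewrite -PE addrC; apply: le_trans hP; rewrite lerD2l -/kappa.
  by rewrite ler_wpM2r // ler_nat.
have lsum : \sum_(S <- s) l S <= l P by rewrite PE sum_log_val_le.
have lower : - ((c1 + h Q) * \sum_(S <- s | S != Q) deg S)
    - (size Q).-2%:R * \sum_(S <- s | S != Q) h S <= \sum_(S <- s | S != Q) l S.
  rewrite !mulr_sumr -!sumrN -big_split /= [leLHS]big_seq_cond [leRHS]big_seq_cond.
  apply: ler_sum => S /andP[Ss SQ]; have pS := ps _ Ss; have S0 := s0 _ Ss.
  have sizeP T : T \in s -> (size T <= n.+1)%N.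
    move=> Ts; apply: leq_trans sP; rewrite dvdp_leq // PE dvdpZr // (big_rem T) //=.
    exact: dvdp_mulIl.
  have dS1 : 1 <= deg S by rewrite (prime_degE pS) lerDr.
  have [_ Q1 _] := pQ; have := Qmin _ Ss.
  have := res Q S (prime_poly_coprime_neq pQ pS _) _ S0 (sizeP _ Ss).
  rewrite eq_sym SQ Q1 sizeP // (prime_degE pQ) => /(_ isT isT) alt lmin.
  exact: other_factor_arith c10 dS1 lmin alt.
rewrite -/m in sumd sumh suml.
have dT0 : 0 <= \sum_(S <- s | S != Q) deg S by rewrite sumr_ge0.
have hT0 : 0 <= \sum_(S <- s | S != Q) h S.
  rewrite big_seq_cond sumr_ge0 // => S /andP[Ss _].
  by rewrite log_height_ge0 ?s0.
move: (\sum_(S <- s | S != Q) deg S) (\sum_(S <- s | S != Q) h S) dT0 hT0 sumd sumh lower => dT hT dT0 hT0 sumd sumh lower.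
have hQ0 : 0 <= h Q by rewrite log_height_ge0.
have D0 : 0 <= (size Q).-2%:R :> R by [].
have m0 : (0 < m)%N by rewrite -has_count; apply/hasP; exists Q => /=.
exists Q, m; split=> //.
- by apply: le_trans degs; rewrite sumd lerDl.
- by apply: le_trans hsum; rewrite sumh lerDl.
rewrite (prime_degE pQ) in sumd *.
apply: (dominant_factor_arith _ _ hQ0 c10 _ _ _ lower) => //.
- by rewrite -sumd.
- by rewrite -sumh.
- by rewrite -suml.
Qed.

Lemma prime_poly_dvd_height Q P :
    prime_poly Q -> P != 0 -> (size P <= n.+1)%N -> Q %| P ->
  h Q <= ln ((2 * n) ^ n)%:R + h P.
Proof.
move=> pQ P0 sP /dvdpP_int[T]; have [Q1 _ _] := pQ; rewrite zprimitive_id1 // => PE.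
have /andP[Q0 T0] : (Q != 0) && (T != 0) by rewrite -negb_or -mulf_eq0 -PE.
rewrite PE in P0 sP *; have bnd := @height_mul_le R[i] n Q T sP P0.
have pos S : S != 0 -> (poly_height S)%:R \is @Num.pos R.
  by move=> S0; rewrite posrE ltr0n height_gt0.
have Kpos : ((2 * n) ^ n)%:R \is @Num.pos R.
  by rewrite posrE ltr0n expn_gt0 muln_gt0 n_gt0.
rewrite /log_height -lnM ?pos // ler_ln ?pos //; last first.
  by rewrite posrE mulr_gt0 // -posrE ?pos.
rewrite -natrM ler_nat; apply: leq_trans bnd.
by rewrite leq_pmulr // height_gt0.
Qed.

Variables (w x0 : R).
Hypothesis w_gt : n%:R - 1 < w.
Hypothesis small_values : forall x, x0 <= x ->
  exists P, [/\ P != 0, (size P <= n.+1)%N, h P <= x & l P <= - (w * x)].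

Lemma w_ge0 : 0 <= w.
Proof. by apply/ltW/(le_lt_trans _ w_gt); rewrite subr_ge0 ler1n. Qed.

(** What [exists_dominant_factor] yields for a polynomial [P] with
    [l P <= - (w * x)], up to the constant [c]. *)
Definition dominant (c x : R) Q (m : nat) : Prop :=
  [/\ prime_poly Q, (0 < m)%N, m%:R * deg Q <= n%:R, m%:R * h Q <= x &
    m%:R * e Q <= c - (w - (size Q).-2%:R) * x + (n%:R - m%:R * deg Q) * h Q].

Lemma dominant_size c x Q m : dominant c x Q m -> (size Q <= n.+1)%N /\ (m <= n)%N.
Proof.
case=> [[_ Q1 _]] m0; rewrite -natrM ler_nat => mQ _ _; split.
  by rewrite -[size Q]prednK ?(ltnW Q1) // ltnS; apply: leq_trans mQ; rewrite leq_pmull.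
apply: leq_trans mQ; rewrite leq_pmulr //.
by rewrite -subn1 subn_gt0.
Qed.

(** For such an [m], a dominant factor [Q] of large height is too small at [xi]:
    a polynomial [S] with [h S <= h Q - k] and [l S <= - (w * (h Q - k))] is not
    a multiple of [Q] by Gelfond's inequality, and the resultant of [Q] and [S]
    then gives a contradiction. *)
Lemma repeated_dominant_bounded (c : R) (m : nat) : 0 <= c ->
    m%:R * n%:R + n%:R - m%:R < m%:R * w ->
  exists B : R, forall x Q, dominant c x Q m -> h Q <= B.
Proof.
move=> c0 wbig; have [c1 c10 res] := resultant_log_bound hxi n.
set kappa : R := ln ((2 * n) ^ n)%:R.
have kappa0 : 0 <= kappa by rewrite ln_ge0 // ler1n expn_gt0 muln_gt0 n_gt0.
set delta := m%:R * w - (m%:R * n%:R + n%:R - m%:R).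
have delta0 : 0 < delta by rewrite subr_gt0.
pose k := kappa + 1.
pose B1 := (c + m%:R * c1 + m%:R * (c1 + w * k)) / delta.
exists (Num.max (x0 + k) B1) => x Q dom; have [sQn mn] := dominant_size dom.
case: dom => pQ m0 mD mh star.
rewrite leNgt gt_max; apply/negP => /andP[big1 big2].
have lo : x0 <= h Q - k by rewrite lerBrDr ltW.
have [S [S0 sS hS lS]] := small_values lo.
have QS : coprimep Q S.
  apply: prime_poly_coprime => //; apply/negP => QS.
  have := prime_poly_dvd_height pQ S0 sS QS; rewrite -/kappa.
  by rewrite /k in hS; lra.
have [_ Q1 _] := pQ.
have Qdeg := prime_degE pQ; rewrite Qdeg in mD star.
have := res Q S QS _ S0 sS; rewrite Q1 sQn => /(_ isT).
rewrite Qdeg => alt.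
have m1 : 1 <= m%:R :> R by rewrite ler1n.
have k0 : 0 <= k by rewrite addr_ge0.
have D1 : (size Q).-2%:R + 1 <= n%:R :> R.
  by rewrite -Qdeg ler_nat -ltnS prednK // ltnW.
have sn : (size S).-1%:R <= n%:R :> R.
  by rewrite ler_nat -ltnS prednK // size_poly_gt0.
have hQ0 : 0 <= h Q by rewrite log_height_ge0 // prime_poly_neq0.
have hSQ : h S <= h Q by lra.
have := repeated_factor_arith m1 (ler0n _ _) c0 c10 k0 w_ge0 hQ0 (ler0n _ _) mD mh
  w_gt D1 sn star hSQ lS alt.
by rewrite -/delta mulrC leNgt -ltr_pdivrMr // -/B1 big2.
Qed.

Lemma repeated_dominant_bounded_uniform (c : R) : 0 <= c ->
  exists B : R, forall m x Q, dominant c x Q m ->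
    m%:R * n%:R + n%:R - m%:R < m%:R * w -> h Q <= B.
Proof.
move=> c0.
suff [B HB] : exists B : R, forall m x Q, (m <= n)%N -> dominant c x Q m ->
    m%:R * n%:R + n%:R - m%:R < m%:R * w -> h Q <= B.
  by exists B => m x Q dom; apply: HB (dom); have [] := dominant_size dom.
elim: {1}n => [|M [B HB]].
  by exists 0 => m x Q; rewrite leqn0 => /eqP-> [].
have [big|small] := ltP (M.+1%:R * n%:R + n%:R - M.+1%:R) (M.+1%:R * w).
  have [B' HB'] := repeated_dominant_bounded c0 big.
  exists (Num.max B B') => m x Q; rewrite leq_eqVlt => /predU1P[->|mM] dom mw.
    by rewrite le_max (HB' _ _ dom) orbT.
  by rewrite le_max (HB _ _ _ mM dom mw).
exists B => m x Q; rewrite leq_eqVlt => /predU1P[->|mM] dom mw; last exact: HB mM dom mw.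
by move: mw; rewrite ltNge small.
Qed.

(** Either the multiplicity of the dominant factor is harmless, or its height is
    bounded; then [l Q] is bounded below by finiteness, hence so is [x] from
    above. *)
Lemma exists_small_prime_poly : exists c x1 : R, forall x, x1 <= x ->
  exists Q, [/\ prime_poly Q, (size Q <= n.+1)%N, h Q <= x &
    e Q <= c - (w - n%:R + 1) * x].
Proof.
have [c' [k [c'0 k0 factor]]] := exists_dominant_factor.
pose c := c' + w * k.
have c0 : 0 <= c by rewrite addr_ge0 // mulr_ge0 // w_ge0.
have [B HB] := repeated_dominant_bounded_uniform c0.
have [L HL] := log_val_lower_bound xi n B.
pose a := w - n%:R + 1.
have a0 : 0 < a by rewrite /a; have := w_gt; lra.
exists c.
exists (Num.max (Num.max (x0 + k) (k + 1)) ((c + n%:R * `|B| + n%:R * `|L|) / a + 1)).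
move=> x; rewrite !ge_max => /andP[/andP[x0k xk]]; set x2 := _ / a => xx2.
have lo : x0 <= x - k by rewrite lerBrDr.
have [P [P0 sP hP lP]] := small_values lo.
have lP0 : l P < 0.
  apply: le_lt_trans lP _; rewrite oppr_lt0 mulr_gt0 //; last by lra.
  by apply: le_lt_trans w_gt; rewrite subr_ge0 ler1n.
have hPk : h P + k <= x by rewrite -lerBrDr.
have [Q [m [pQ m0 mD mh star]]] := factor P x P0 sP lP0 hPk.
have dom : dominant c x Q m.
  by split=> //; rewrite /c; lra.
have [sQn mn] := dominant_size dom.
have Q0 := prime_poly_neq0 pQ; have hQ0 : 0 <= h Q by rewrite log_height_ge0.
have m1 : 1 <= m%:R :> R by rewrite ler1n.
have Qdeg := prime_degE pQ.
case: (dom) => _ _ mD' _ star'; rewrite Qdeg in mD' star'.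
have xpos : 0 <= x by lra.
have hx : h Q <= x by apply: le_trans mh; rewrite ler_peMl.
exists Q; split=> //.
have [big|small] := ltP (m%:R * n%:R + n%:R - m%:R) (m%:R * w); last first.
  apply: (single_factor_arith m1 _ xpos c0 mD' mh _ star') => //.
  by rewrite mulr_ge0_le0 ?subr_ge0 // subr_le0.
have hB : h Q <= B by exact: HB dom big.
exfalso; have lL := HL Q sQn hB Q0.
have := bounded_factor_arith m1 (ler0n _ _) xpos hQ0 w_gt mD' hB lL star'.
by rewrite -/a -/x2; lra.
Qed.

End MainEstimate.

(** * Uniform exponents *)

Lemma lee_dense_below (R : realType) (u : R) (y : \bar R) :
  (forall v : R, v < u -> (v%:E <= y)%E) -> (u%:E <= y)%E.
Proof.
case: y => [r| |] h; last 2 first.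
- by rewrite leey.
- by have := h (u - 1); rewrite leeNy_eq; apply; lra.
rewrite lee_fin leNgt; apply/negP => ru.
by have := h ((r + u) / 2); rewrite lee_fin => /(_ _); lra.
Qed.

Lemma prime_polyX : prime_poly 'X.
Proof.
split; rewrite ?zcontents_monic ?monicX ?size_polyX // => S SX S1.
by apply/eqP; rewrite eqn_leq S1 andbT -[leqRHS](size_polyX int) dvdp_leq // polyX_eq0.
Qed.

Section Final.
Variables (R : realType) (n : nat) (xi : R).
Hypotheses (n_gt0 : (0 < n)%N) (hxi : transcendental xi).

Lemma prime_root_admissible (X : R) (Q : {poly int}) (a : R[i]) :
    0 < X -> prime_poly Q -> (size Q <= n.+1)%N -> log_height R Q <= ln X ->
    algebraic_number a -> int_minpoly a = Q ->
  alg_admissible n X a.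
Proof.
move=> X0 pQ sQ hQ alg_a aQ; split=> //.
  rewrite /alg_degree aQ; move: sQ; have [_ + _] := pQ.
  by case: (size Q).
rewrite /alg_height aQ -ler_ln ?posrE // ltr0n height_gt0 //.
exact: prime_poly_neq0.
Qed.

(** The fixed number [0] already shows this. *)
Lemma wstar_hat_ge0 : (0 <= wstar_hat n xi)%E.
Proof.
apply: lee_dense_below => v v0; apply: limf_einf_ge.
have pX := prime_polyX; have X0 : root (map_poly intr 'X : {poly R[i]}) 0.
  by rewrite map_polyX rootX.
have aX := algebraic_number_root (prime_poly_neq0 pX) X0.
have mX := int_minpoly_prime pX X0.
pose M := Num.max (log_height R 'X) (ln (alg_val xi 0) / - v).
exists (Num.max 1 (expR M)); split=> // X; rewrite gt_max => /andP[X1 MX].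
have Xpos : 0 < X by apply: lt_trans X1.
have : M <= ln X by rewrite -[M]expRK ler_ln ?posrE ?expR_gt0 // ltW.
rewrite ge_max => /andP[hX vX].
apply: (@wstar_at_ge _ _ _ _ _ 0) => //.
  by apply: prime_root_admissible pX _ hX aX mX; rewrite ?size_polyX.
by rewrite -mulNr mulrC -ler_pdivrMr // oppr_gt0.
Qed.

(** With [X = expR x], the slack [v < w - n + 1] absorbs all constants. *)
Lemma wstar_hat_ge (w : R) :
  (w%:E < w_hat n xi)%E -> ((w - (n%:R - 1))%:E <= wstar_hat n xi)%E.
Proof.
move=> /limf_einf_gt[M [_ HM]].
have [wn|wn] := leP w (n%:R - 1).
  by apply: le_trans wstar_hat_ge0; rewrite lee_fin subr_le0.
have w0 : 0 <= w by apply/ltW/(le_lt_trans _ wn); rewrite subr_ge0 ler1n.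
pose M1 := Num.max M 1 + 1.
have M1pos : 0 < M1 by rewrite ltr_wpDl // le_max ler01 orbT.
have small x : ln M1 <= x -> exists P : {poly int}, [/\ P != 0,
    (size P <= n.+1)%N, log_height R P <= x & log_val xi P <= - (w * x)].
  move=> Mx; have : M1 <= expR x by rewrite -ler_ln ?posrE ?expR_gt0 // expRK.
  have M1M : Num.max M 1 < M1 by rewrite ltrDl.
  move: M1M; rewrite gt_max => /andP[MM1 oneM1] M1x.
  have := poly_of_w_at_gt hxi (lt_le_trans oneM1 M1x) w0.
  by rewrite expRK; apply; apply: HM; apply: lt_le_trans M1x.
have [c [x1 main]] := exists_small_prime_poly hxi n_gt0 wn small.
have [c2 near] := near_root_log n hxi.
apply: lee_dense_below => v vw; apply: limf_einf_ge.
pose a := w - n%:R + 1.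
have a0 : 0 < a by rewrite /a; lra.
have av : 0 < a - v by rewrite /a; lra.
pose B := Num.max x1 (Num.max (c / a) ((c + c2) / (a - v))).
exists (Num.max 1 (expR B)); split=> // X; rewrite gt_max => /andP[X1 BX].
have Xpos : 0 < X by apply: lt_trans X1.
have : B < ln X by rewrite -[B]expRK ltr_ln ?posrE ?expR_gt0.
rewrite !gt_max => /and3P[x1X cX c2X].
have [Q [pQ sQ hQ eQ]] := main _ (ltW x1X).
have hQ0 : 0 <= (size Q).-2%:R * log_height R Q.
  by rewrite mulr_ge0 // log_height_ge0 // prime_poly_neq0.
rewrite -/a in eQ; rewrite ltr_pdivrMr // in cX.
rewrite ltr_pdivrMr // in c2X.
have lQ0 : log_val xi Q < 0 by rewrite mulrC in cX; lra.
have [b [alg_b bQ lnb]] := near Q pQ sQ lQ0.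
apply: (@wstar_at_ge _ _ _ _ _ b) => //.
  exact: prime_root_admissible bQ.
lra.
Qed.

End Final.

Theorem theorem2p2 (R : realType) (n : nat) (xi : R) (hn : (1 <= n)%N)
    (hxi : transcendental xi)
    (hcond :
      [\/ w_hat n xi = n%:R%:E,
          (((2 * n%:R - 3)%:E : \bar R) < w_hat n xi)%E,
          (((n%:R - 2)%:E : \bar R) <= wstar_hat n xi)%E |
      [\/ (((n%:R^-1)%:E <= lambda_sup n xi)%E /\
             (lambda_sup n xi <= inv_n_minus_2 R n)%E) \/
          (1%:E < lambda_sup n xi)%E,
          (n%:R%:E <= w_sup 1 xi)%E |
          (w_sup n xi <= ((2 * n%:R - 1 + Num.sqrt (4 * n%:R - 3)) / 2)%:E)%E ]]) :
  (w_hat n xi - wstar_hat n xi <= (n%:R - 1)%:E)%E.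
Proof.
have lower := wstar_hat_ge hn hxi; have ge0 := wstar_hat_ge0 hn hxi.
case: (w_hat n xi) lower => [W| |] lower.
- have := @lee_dense_below R (W - (n%:R - 1)) (wstar_hat n xi).
  case: (wstar_hat n xi) ge0 lower => [r| |] // _ lower h; last first.
    by rewrite addeNy leNye.
  rewrite -EFinD lee_fin; have := h _; rewrite lee_fin => h'.
  rewrite lerBlDr -lerBlDl; apply: h' => v vW.
  have := lower (v + (n%:R - 1)); rewrite lte_fin addrK; apply; lra.
- case: (wstar_hat n xi) ge0 lower => [r| |] // _ lower.
  by exfalso; have := lower (r + n%:R)%R (ltry _); rewrite lee_fin; lra.
  by rewrite leNye.
by rewrite addNye leNye.
Qed.
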